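(* Let $\boldsymbol\lambda=(\lambda^0\mid\cdots\mid\lambda^{r-1})$ be an $r$-partite partition of size $n$ with $\lambda^t=\lambda^{r-t}$ for $1\le t<r/2$, and write $\lambda^t=\langle1^{m_{t,1}},2^{m_{t,2}},\dots\rangle$ in frequency notation for $0\le t\le r-1$. Identify the variable $x_{r-t,k}$ with $x_{t,k}$ for $1\le t<r/2$. Then $\Gamma_{\boldsymbol\lambda}$ is the coefficient of $(x_{0,1}^{m_{0,1}}\cdots x_{0,n}^{m_{0,n}})\cdots(x_{r-1,1}^{m_{r-1,1}}\cdots x_{r-1,n}^{m_{r-1,n}})$ in \[\begin{cases}\displaystyle\prod_{k\ge1}\Big(\mathcal{D}(2kr\,x_{0,2k}^2)\,\mathcal{R}_{(2k-1)/r}(r\,x_{0,2k-1})\prod_{t=1}^{(r-1)/2}\mathcal{F}(kr\,x_{t,k}^2)\Big) & r\text{ odd},\\[0.3cm] \displaystyle\prod_{k\ge1}\Big(\mathcal{D}(2kr\,x_{0,2k}^2)\,\mathcal{D}(rk\,x_{r/2,k}^2)\,\mathcal{R}_{(2k-1)/r}(r\,x_{0,2k-1})\prod_{t=1}^{(r-2)/2}\mathcal{F}(kr\,x_{t,k}^2)\Big) & r\text{ even}.\end{cases}\] Therefore the generating function $\mathcal{S}^r(x)=\sum_{n\ge0}s(G(r,1,n))x^n$ of the character table sums is \[\mathcal{S}^r(x)=\begin{cases}\displaystyle\prod_{k\ge1}\Big(\mathcal{F}(kr\,x^{2k})^{(r-1)/2}\,\mathcal{D}(2kr\,x^{4k})\,\mathcal{R}_{(2k-1)/r}(r\,x^{2k-1})\Big)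 & r\text{ odd},\\[0.3cm] \displaystyle\prod_{k\ge1}\Big(\mathcal{F}(kr\,x^{2k})^{(r-2)/2}\,\mathcal{D}(2kr\,x^{4k})\,\mathcal{D}(rk\,x^{2k})\,\mathcal{R}_{(2k-1)/r}(r\,x^{2k-1})\Big) & r\text{ even}.\end{cases}\]
   Context: $G(r,1,n)=\{(z_1,\dots,z_n;\sigma):z_i\in\mathbb{Z}_r,\sigma\in S_n\}$ with product $(z;\sigma)(z';\sigma')=(z_1+z'_{\sigma^{-1}(1)},\dots,z_n+z'_{\sigma^{-1}(n)};\sigma\sigma')$. The color of a cycle $(u_1,\dots,u_\ell)$ of $\sigma$ is $z_{u_1}+\cdots+z_{u_\ell}$; the cycle type is $(\lambda^0\mid\cdots\mid\lambda^{r-1})$ with $\lambda^j$ the partition of lengths of color-$j$ cycles; conjugacy classes are indexed by cycle types. $\Gamma_{\boldsymbol\lambda}$ is the sum of the column of the complex character table of $G(r,1,n)$ at the class of cycle type $\boldsymbol\lambda$; it equals the number of $\pi\in G(r,1,n)$ with $\pi\overline\pi=g$ for $g$ of that cycle type, where $\overline{(z_1,\dots,z_n;\sigma)}=(-z_1,\dots,-z_n;\sigma)$. $s(G)$ is the sum of all entries of the character table. In frequency notation, $m_{t,j}$ is the number of parts of $\lambda^t$ equal to $j$. $(2k-1)!!=(2k-1)(2k-3)\cdots1$, $(-1)!!=1$; $\mathcal{D}(x)=\sum_{n\ge0}(2n-1)!!x^n$; $\mathcal{F}(x)=\sum_{n\ge0}n!\,x^n$; for a parameter $c$, $\mathcal{R}_c(x)=\sum_{n\ge0}o_c(n)x^n$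 with $o_c(n)=\sum_{k=0}^{\lfloor n/2\rfloor}\binom{n}{2k}(2k-1)!!\,c^k$. *)

(* Defs.v *)
From HB Require Import structures.
From mathcomp Require Import all_boot all_order all_algebra all_fingroup all_solvable all_field all_character.
Set Implicit Arguments. Unset Strict Implicit. Unset Printing Implicit Defensive.
Import GRing.Theory Num.Theory.
Local Open Scope ring_scope.

(* Colours Z_r are modelled by 'I_(r.-1.+1) (= 'I_r when 0 < r), with the
   cyclic successor ordS.  G(r,1,n) is realised as the group of permutations
   of Z_r x [n] commuting with the colour shift (c,i) |-> (c+1,i); the element
   (z;sigma) of the paper corresponds to the permutation
   (c,i) |-> (c + z_i, sigma^-1 i)  (a group isomorphism for MathComp's
   left-to-right composition of permutations). *)
Definition colour (r : nat) := 'I_(r.-1.+1).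

Definition shift_fun (r n : nat) (x : colour r * 'I_n) : colour r * 'I_n :=
  (ordS x.1, x.2).

Lemma shift_fun_inj r n : injective (@shift_fun r n).
Proof.
move=> [a i] [b j] /= [] Hab ->.
have E : ordS a = ordS b by apply: val_inj.
by rewrite -(ordSK a) E ordSK.
Qed.

Definition cshift (r n : nat) : {perm colour r * 'I_n} := perm (@shift_fun_inj r n).

Definition Grn (r n : nat) : {group {perm colour r * 'I_n}} := 'C[cshift r n]%G.

Definition pos r n (g : {perm colour r * 'I_n}) (i : 'I_n) : 'I_n := (g (ord0, i)).2.

(* colour of the cycle through i: the total colour shift after going once
   around the cycle of positions containing i *)
Definition cyc_colour r n (g : {perm colour r * 'I_n}) (i : 'I_n) : nat :=
  val (((g ^+ (fingraph.order (pos g) i))%g) (ord0, i)).1.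

Definition cycles_of_type r n (g : {perm colour r * 'I_n}) (t k : nat)
  : {set {set 'I_n}} :=
  [set [set j | fconnect (pos g) i j] | i : 'I_n &
      (fingraph.order (pos g) i == k)%N && (cyc_colour g i == t)%N].

(* m_{t,k}: number of parts of lambda^t equal to k *)
Definition mult r n (g : {perm colour r * 'I_n}) (t k : nat) : nat :=
  #|cycles_of_type g t k|.

Definition Gamma r n (g : {perm colour r * 'I_n}) : algC :=
  \sum_(i < Nirr (Grn r n)) 'chi[Grn r n]_i g.

Definition table_sum (gT : finGroupType) (G : {group gT}) : algC :=
  \sum_i \sum_j character_table G i j.

Definition series := nat -> algC.

Definition sone : series := fun m => (m == 0)%:R.
Definition smul (A B : series) : series :=
  fun m => \sum_(i < m.+1) A i * B (m - i)%N.
Definition spow (A : series) (e : nat) : series := iter e (smul A) sone.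

Definition scomp (A : series) (c : algC) (j : nat) : series :=
  fun m => if (0 < j)%N && (j %| m)%N then A (m %/ j)%N * c ^+ (m %/ j) else 0.

(* (2k-1)!!, with (-1)!! = 1 *)
Fixpoint dfact (k : nat) : nat :=
  match k with 0 => 1 | k'.+1 => (k'.*2.+1 * dfact k')%N end.

Definition Dser : series := fun m => (dfact m)%:R.
Definition Fser : series := fun m => (m`!)%:R.
Definition ocoef (c : algC) (m : nat) : algC :=
  \sum_(k < m./2.+1) ('C(m, k.*2))%:R * (dfact k)%:R * c ^+ k.
Definition Rser (c : algC) : series := ocoef c.

(* Coefficient of x^m in an infinite product prod_{k>=1} P k, where
   P k = 1 + O(x^k) (so factors with k > m do not affect x^m). *)
Definition iprod_coef (P : nat -> series) (m : nat) : algC :=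
  (\big[smul/sone]_(1 <= k < m.+1) P k) m.

(* Main.v *)
Require Import Defs.
From HB Require Import structures.
From mathcomp Require Import all_boot all_order all_algebra all_fingroup all_solvable all_field all_character.
From mathcomp Require Import zify ring.
Set Implicit Arguments. Unset Strict Implicit. Unset Printing Implicit Defensive.
Import GRing.Theory Num.Theory.
Local Open Scope ring_scope.

(* Let [nu] negate the colours and [star w] be the conjugate of [w^-1] by [nu], an
   anti-automorphism of G(r,1,n); the paper's bar is conjugation by [nu].  Along the chain
   of the subgroups fixing the positions [>= k], every element is conjugate to its [star]
   under the previous subgroup, so the centraliser algebras of the chain are fixed by [star].
   Hence for every irreducible representation some [star]-fixed element of the group algebra
   acts with rank one, which forces the [star]-invariant bilinear form to be symmetric: all
   twisted Frobenius-Schur indicators are 1, and [Gamma g] counts the [p] with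
   [p * nu p nu = g].

   Writing [th = p nu], these are the square roots of [g] inverting the colour shift.  Such
   a [th] matches cycles of colour [t] with cycles of colour [- t] of the same length [k],
   in [k r] ways per pair, and stabilises only odd cycles of colour 0, in [r] ways each.
   Choosing the image of one point gives a recursion in the cycle multiplicities, which the
   product formula satisfies.  For the table sum one then sums over the classes, that is
   over all cycle types of size [n]. *)

(** * Twisted Frobenius-Schur indicators *)

(** The chain condition is Gelfand's trick: [star] reverses products, so a centraliser algebra that
    it fixes is commutative, and composing equivariant projections down the chain cuts out a line.
    Only that line is needed: [has_rank1_star] climbs the chain, and no irreducible is ever
    constructed. Conjugacy of [g] and [star g] alone would leave a sign open, since the form could
    be alternating; a rank-one matrix cannot be.

    A root [th] commutes with its square [g] and inverts the shift, so its value [y] at [x]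
    determines it on the cycles of [x] and [y]; hence the [k r] choices. On a stabilised cycle it
    acts as [g ^+ b] up to colour with [2 b = 1] modulo the length, hence odd lengths, one [b] and
    [r] free shifts.

    So odd cycles of colour 0 carry involutions of weight [r] per fixed point and [k r] per pair;
    extracting [r] per point leaves [k r / r^2 = k / r], the parameter of [Rser]. Even cycles of
    colour 0 and all cycles of colour [r/2] admit only perfect matchings ([Dser]), and a pair of
    distinct opposite colours bijections ([Fser]). *)

Section TwistedFrobeniusSchur.

Variables (gT : finGroupType) (u : gT).
Hypothesis uu : (u * u = 1)%g.

Definition star (g : gT) : gT := (g^-1 ^ u)%g.

Lemma starK : involutive star.
Proof. by move=> g; rewrite /star -conjVg invgK -conjgM uu conjg1. Qed.

Lemma starM g h : star (g * h)%g = (star h * star g)%g.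
Proof. by rewrite /star invMg conjMg. Qed.

Lemma starV g : star g^-1%g = (star g)^-1%g.
Proof. by rewrite /star conjVg. Qed.

Lemma mem_star (G : {group gT}) g : u \in 'N(G)%g -> (star g \in G) = (g \in G).
Proof. by move=> nGu; rewrite /star memJ_norm ?groupV. Qed.

Definition gsum (G : {group gT}) n (rG : mx_representation algC G n)
  (x : gT -> algC) := \sum_(g in G) x g *: rG g.

Definition has_rank1_star (G : {group gT}) :=
  forall n (rG : mx_representation algC G n), mx_irreducible rG ->
  exists2 x, {in G, forall g, x (star g) = x g} & \rank (gsum rG x) = 1%N.

Lemma rank1_minor n (Y : 'M[algC]_n) i j k l :
  \rank Y = 1%N -> Y i j * Y k l = Y i l * Y k j.
Proof.
move=> rY; move: (mulmx_base Y); move: (col_base Y) (row_base Y).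
rewrite rY => c r <-; rewrite !mxE !big_ord_recl !big_ord0 !addr0.
by rewrite mulrACA [r 0 j * _]mulrC mulrACA.
Qed.

(** For [e] other than 1 the diagonal vanishes, and the 2x2 minors then give [Y i j * Y j i = 0],
    where each factor is [e] times the other. *)
Lemma rank1_eps n (Y : 'M[algC]_n) e : \rank Y = 1%N -> Y^T = e *: Y -> e = 1.
Proof.
move=> rY /matrixP YT; apply: contra_eq (rY) => ne1.
have Yd i : Y i i = 0.
  have /eqP := YT i i; rewrite !mxE -subr_eq0 -{1}[Y i i]mul1r -mulrBl mulf_eq0.
  by rewrite subr_eq0 eq_sym (negPf ne1) => /eqP.
suff ->: Y = 0 by rewrite mxrank0.
apply/matrixP=> i j; rewrite mxE; apply/eqP.
have := rank1_minor i j j i rY; rewrite !Yd mul0r => /eqP.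
rewrite mulf_eq0 => /orP[] // Yji.
by have := YT j i; rewrite !mxE (eqP Yji) mulr0 => ->.
Qed.

(** [U] includes an irreducible [H]-submodule; [q] is a mere linear retraction, to be averaged over
    [H] later. *)
Lemma irr_subrepr (H G : {group gT}) n (rG : mx_representation algC G n) :
    H \subset G -> (0 < n)%N ->
  exists m (rW : mx_representation algC H m) (U : 'M_(m, n)) (q : 'M_(n, m)),
    [/\ mx_irreducible rW, {in H, forall h, U *m rG h = rW h *m U}
      & U *m q = 1%:M].
Proof.
move=> sHG n_gt0; pose rH := subg_repr rG sHG.
have nz1: (1%:M : 'M[algC]_n) != 0 by rewrite -mxrank_eq0 mxrank1 -lt0n.
have [M simM _] := dec_mxsimple_exists (mxmodule1 rH) nz1.
have [modM nzM _] := simM.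
exists (\rank M), (submod_repr modM), (val_submod 1%:M), (in_submod M 1%:M).
split; first exact/submod_mx_irr.
  move=> h Hh; have := val_submodJ modM 1%:M Hh.
  by rewrite mul1mx [LHS]val_submodE => ->.
by rewrite -in_submodE val_submodK.
Qed.

(* An [H]-invariant element of the group algebra of [G] is fixed by [star],
   so the projection onto an irreducible [H]-submodule is too. *)
Lemma has_rank1_star_ext (H G : {group gT}) :
    H \subset G -> u \in 'N(H)%g -> u \in 'N(G)%g ->
    {in G, forall g, exists2 h, h \in H & (g ^ h)%g = star g} ->
  has_rank1_star H -> has_rank1_star G.
Proof.
move=> sHG nHu nGu conjG rkH n rG irrG.
have [n_gt0 _] := (mx_irrP rG).1 irrG.
have [m [rW [U [q0 [irrW UJ Uq0]]]]] := irr_subrepr rG sHG n_gt0.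
have [x xstar rkx] := rkH _ rW irrW.
have nzH : #|H|%:R != 0 :> algC by rewrite pnatr_eq0 -lt0n cardG_gt0.
(* Maschke averaging turns [q0] into an [H]-equivariant retraction. *)
pose q := #|H|%:R^-1 *: \sum_(h in H) rG h *m q0 *m rW (h^-1)%g.
have Uq : U *m q = 1%:M.
  rewrite /q -scalemxAr mulmx_sumr (eq_bigr (fun _ => 1%:M)) => [|h Hh].
    by rewrite sumr_const -scaler_nat scalerA mulVf // scale1r.
  by rewrite !mulmxA UJ // -(mulmxA (rW h)) Uq0 mulmx1 -repr_mxM ?groupV // mulgV repr_mx1.
have qJ k : k \in H -> rG k *m q = q *m rW k.
  move=> Hk; rewrite /q -scalemxAr -scalemxAl mulmx_sumr mulmx_suml; congr (_ *: _).
  rewrite [RHS](reindex_inj (mulgI k)) /=.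
  apply: eq_big => [h|h Hh]; first by rewrite groupMl.
  rewrite invMg -[RHS]mulmxA -(repr_mxM rW) ?groupM ?groupV // mulgKV !mulmxA.
  by rewrite -(repr_mxM rG) ?(subsetP sHG).
pose p := q *m U.
have pJ h : h \in H -> rG h *m p = p *m rG h.
  by move=> Hh; rewrite /p mulmxA qJ // -[LHS]mulmxA -UJ // mulmxA.
(* By Burnside, [rG] spans the full matrix algebra, so the projection [p] comes from the group
   algebra. *)
have [_ [a_ a_P]] := mx_abs_irrP (groupC irrG).
pose a g := a_ g p.
have ap : p = \sum_(g in G) a g *: rG g by apply: a_P.
(* Averaging over conjugation by [H] keeps the image [p], which commutes with [H], and makes the
   coefficients constant on [H]-orbits, hence [star]-fixed. *)
pose b g := #|H|%:R^-1 * \sum_(h in H) a (g ^ h)%g.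
have bJ g k : k \in H -> b (g ^ k)%g = b g.
  move=> Hk; congr (_ * _); rewrite [RHS](reindex_inj (mulgI k)) /=.
  by apply: eq_big => [h|h Hh]; rewrite ?groupMl // conjgM.
have bp : gsum rG b = p.
  have ->: p = #|H|%:R^-1 *: \sum_(h in H) rG h *m p *m rG (h^-1)%g.
    rewrite (eq_bigr (fun _ => p)) => [|h Hh].
      by rewrite sumr_const -scaler_nat scalerA mulVf // scale1r.
    have Gh := subsetP sHG h Hh.
    by rewrite pJ // -mulmxA -repr_mxM ?groupV // mulgV repr_mx1 mulmx1.
  rewrite /gsum /b; under eq_bigr do rewrite -scalerA scaler_suml.
  rewrite -scaler_sumr; congr (_ *: _); rewrite exchange_big /=.
  apply: eq_bigr => h Hh; have Gh := subsetP sHG h Hh.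
  rewrite {1}ap mulmx_sumr mulmx_suml [RHS](reindex_inj (conjg_inj h)) /=.
  apply: eq_big => [g|g Gg]; first by rewrite groupJr.
  rewrite -scalemxAr -scalemxAl -!repr_mxM ?groupM ?groupV ?groupJ //.
  by rewrite conjgE !mulgA mulgV mul1g mulgK.
have bstar g : g \in G -> b (star g) = b g.
  by move=> /conjG[h Hh <-]; rewrite bJ.
(* The convolution of [b] and [x]: [star] swaps the factors, but [b] commutes with the elements of
   [H]. It acts as [x] on the submodule and as 0 on the kernel of [p]. *)
exists (fun g => \sum_(h in H) b (g * h^-1)%g * x h) => [g Gg|].
  rewrite (reindex_inj (can_inj starK)) /=.
  apply: eq_big => [h|h]; rewrite mem_star // => Hh.
  rewrite xstar // -starV -starM bstar ?groupM ?groupV // ?(subsetP sHG) //.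
  by rewrite -(bJ _ h^-1%g) ?groupV // conjgE invgK !mulgA mulgV mul1g.
have ->: gsum rG (fun g => \sum_(h in H) b (g * h^-1)%g * x h)
         = q *m gsum rW x *m U.
  transitivity (p *m \sum_(h in H) x h *: rG h).
    rewrite -bp /gsum mulmx_sumr; under eq_bigr do rewrite scaler_suml.
    rewrite exchange_big /=; apply: eq_bigr => h Hh; have Gh := subsetP sHG h Hh.
    rewrite mulmx_suml (reindex_inj (mulIg h)) /=.
    apply: eq_big => [g|g]; rewrite groupMr // => Gg.
    by rewrite mulgK -scalemxAl -scalemxAr scalerA repr_mxM.
  rewrite /p -!mulmxA; congr (_ *m _); rewrite mulmx_sumr mulmx_suml.
  by apply: eq_bigr => h Hh; rewrite -scalemxAr -scalemxAl UJ.
have fU : row_free U by apply/row_freeP; exists q.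
have fq : row_full q by apply/row_fullP; exists U.
by rewrite mxrankMfree // eqmxMfull.
Qed.

Lemma has_rank1_star1 : has_rank1_star 1%G.
Proof.
move=> n rG irrG; exists (fun=> 1) => //.
have n1 : n = 1%N by apply: mx_irr_abelian_linear irrG (abelian1 gT); apply: groupC.
by rewrite /gsum big_set1 repr_mx1 scale1r mxrank1.
Qed.

Section Model.

Variable G : {group gT}.
Hypothesis nGu : u \in 'N(G)%g.
Hypothesis conjG : {in G, forall g, exists2 h, h \in G & (g ^ h)%g = star g}.
Hypothesis rkG : has_rank1_star G.

(** The transposed [star]-representation has the same character, so some [B] identifies it with
    [rG]; Schur makes [B^T] a multiple [e *: B], and the rank-one element decides that [e = 1]. *)
Lemma invariant_form n (rG : mx_representation algC G n) : mx_irreducible rG ->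
  exists B, [/\ B \in unitmx, B^T = B &
    {in G, forall g, rG g *m B = B *m (rG (star g))^T}].
Proof.
move=> irrG; have [n_gt0 _] := (mx_irrP rG).1 irrG.
have reprS : mx_repr G (fun g => (rG (star g))^T).
  split=> [|g h Gg Gh]; first by rewrite /star invg1 conj1g repr_mx1 trmx1.
  by rewrite starM repr_mxM ?mem_star // trmx_mul.
pose rS := MxRepresentation reprS.
have /eqP/cfRepr_rsimP[B _] : cfRepr rG = cfRepr rS.
  apply/cfun_inP=> g Gg; have [h Gh Egh] := conjG Gg.
  by rewrite !cfunE Gg /= mxtrace_tr -Egh !repr_mxM ?groupM ?groupV // mxtrace_mulC repr_mxK.
rewrite row_free_unit => uB homB.
have {}homB : {in G, forall g, rG g *m B = B *m (rG (star g))^T} by [].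
exists B; split=> //.
have /is_scalar_mxP[e De] : is_scalar_mx (B^T *m invmx B).
  apply: (mx_abs_irr_cent_scalar (groupC irrG)); apply/centgmxP=> g Gg.
  have Gs : star g \in G by rewrite mem_star.
  have := congr1 trmx (homB _ Gs); rewrite starK !trmx_mul trmxK => E.
  have E2 : invmx B *m rG g = (rG (star g))^T *m invmx B.
    by apply: (can_inj (mulKmx uB)); rewrite mulKVmx // mulmxA -homB // mulmxK.
  by rewrite -mulmxA E2 !mulmxA E.
have {De} BT : B^T = e *: B by rewrite -mul_scalar_mx -De mulmxKV.
have [x xstar rkx] := rkG irrG.
have XB : gsum rG x *m B = B *m (gsum rG x)^T.
  rewrite mulmx_suml /gsum linear_sum mulmx_sumr /= [RHS](reindex_inj (can_inj starK)) /=.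
  apply: eq_big => [g|g Gg]; first by rewrite mem_star.
  by rewrite linearZ /= -scalemxAl -scalemxAr homB ?xstar.
rewrite BT (@rank1_eps _ (gsum rG x *m B) e) ?scale1r //.
  by rewrite mxrankMfree // row_free_unit.
by rewrite trmx_mul BT -scalemxAl XB.
Qed.

(** Through [B], [rG (g ^ u)] becomes the transpose of [rG g^-1], and orthogonality collapses the
    sum to [#|G| / n] times the trace of [B *m invmx B]; the symmetry of [B] fixes the sign. *)
Lemma twisted_indicator n (rG : mx_representation algC G n) :
  mx_irreducible rG -> \sum_(g in G) cfRepr rG (g * g ^ u)%g = #|G|%:R.
Proof.
move=> irrG; have [n_gt0 _] := (mx_irrP rG).1 irrG.
have [B [uB BT homB]] := invariant_form irrG.
have nz_n : n%:R != 0 :> algC by rewrite pnatr_eq0 -lt0n.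
(* Schur orthogonality of matrix entries: [X] commutes with [rG], hence is scalar, and its trace
   gives the scalar. *)
have ortho i1 j1 l k : \sum_(g in G) rG g i1 j1 * rG (g^-1)%g l k
    = #|G|%:R / n%:R * ((j1 == l) && (i1 == k))%:R.
  pose X := \sum_(g in G) rG g *m delta_mx j1 l *m rG (g^-1)%g.
  have /is_scalar_mxP[c Dc] : is_scalar_mx X.
    apply: (mx_abs_irr_cent_scalar (groupC irrG)); apply/centgmxP=> h Gh.
    rewrite /X mulmx_suml mulmx_sumr [LHS](reindex_inj (mulgI h)) /=.
    apply: eq_big => [g|g]; rewrite groupMl // => Gg.
    by rewrite invMg -[LHS]mulmxA -repr_mxM ?groupM ?groupV // mulgKV repr_mxM // !mulmxA.
  have cE : c * n%:R = #|G|%:R * (j1 == l)%:R.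
    transitivity (\tr X); first by rewrite Dc mxtrace_scalar mulr_natr.
    rewrite /X linear_sum /= (eq_bigr (fun _ => (j1 == l)%:R)) => [|g Gg].
      by rewrite sumr_const mulr_natl.
    rewrite mxtrace_mulC mulmxA -repr_mxM ?groupV // mulVg repr_mx1 mul1mx.
    rewrite /mxtrace (bigD1 l) //= big1 ?addr0 => [|m /negPf ml]; rewrite mxE ?eqxx ?ml ?andbF //.
    by rewrite andbT eq_sym.
  have ->: \sum_(g in G) rG g i1 j1 * rG (g^-1)%g l k = X i1 k.
    rewrite summxE; apply: eq_bigr => g _; rewrite -mulmxA mxE (bigD1 j1) //=.
    rewrite [X in _ + X]big1 ?addr0 => [|m /negPf mj]; last first.
      by rewrite [X in _ * X]mxE big1 ?mulr0 // => z _; rewrite mxE mj mul0r.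
    congr (_ * _); rewrite mxE (bigD1 l) //= big1 ?addr0 => [|m /negPf ml].
      by rewrite mxE !eqxx mul1r.
    by rewrite mxE ml andbF mul0r.
  rewrite Dc mxE; have ->: c = #|G|%:R / n%:R * (j1 == l)%:R.
    by rewrite mulrAC -cE mulfK.
  by rewrite -mulnb natrM -[LHS]mulr_natr mulrA.
have Etau g : g \in G -> rG (g ^ u)%g = B *m (rG (g^-1)%g)^T *m invmx B.
  move=> Gg; have := homB (g ^ u)%g; rewrite memJ_norm // => /(_ Gg).
  by rewrite /star -conjVg -conjgM uu conjg1 => <-; rewrite mulmxK.
have symB j1 i1 : B j1 i1 = B i1 j1 by rewrite -{1}BT mxE.
transitivity (\sum_(g in G) \sum_i1 \sum_j1 \sum_k \sum_l
    (B j1 k * invmx B l i1) * (rG g i1 j1 * rG (g^-1)%g l k)).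
  apply: eq_bigr => g Gg; rewrite cfunE groupM ?memJ_norm //= repr_mxM ?memJ_norm //.
  rewrite Etau // mulr1n; apply: eq_bigr => i1 _; rewrite mxE; apply: eq_bigr => j1 _.
  rewrite -mulmxA mxE mulr_sumr; apply: eq_bigr => k _; rewrite mxE !mulr_sumr.
  by apply: eq_bigr => l _; rewrite mxE; ring.
rewrite exchange_big /=; under eq_bigr => i1 _.
  rewrite exchange_big /=; under eq_bigr => j1 _.
    rewrite exchange_big /=; under eq_bigr => k _.
      rewrite exchange_big /=; under eq_bigr do rewrite -mulr_sumr ortho.
      rewrite (bigD1 j1) //= big1 ?addr0 => [|l /negPf]; last first.
        by rewrite eq_sym => ->; rewrite !mulr0.
      rewrite eqxx /=.
      over.
    rewrite (bigD1 i1) //= big1 ?addr0 => [|k /negPf]; last first.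
      by rewrite eq_sym => ->; rewrite !mulr0.
    rewrite eqxx mulr1 symB.
    over.
  have ->: \sum_j1 B i1 j1 * invmx B j1 i1 * (#|G|%:R / n%:R) = #|G|%:R / n%:R.
    rewrite -mulr_suml; have := congr1 (fun A : 'M_n => A i1 i1) (mulmxV uB).
    by rewrite !mxE eqxx => ->; rewrite mul1r.
  over.
by rewrite sumr_const card_ord -[LHS]mulr_natr mulfVK.
Qed.

(** The root count is a class function, and its inner product with each irreducible character is the
    conjugate of a twisted indicator, that is 1. *)
Lemma sum_irr_twisted_roots g : g \in G ->
  \sum_i 'chi[G]_i g = #|[set p in G | (p * p ^ u == g)%g]|%:R.
Proof.
move=> Gg; pose N x := #|[set p in G | (p * p ^ u == x)%g]|.
have Nclass : is_class_fun <<G>>%g [ffun x => (N x)%:R *+ (x \in G) : algC].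
  rewrite genGid; apply: intro_class_fun => [x y Gx Gy | _ /negbTE-> //].
  rewrite groupJr // Gx !mulr1n; congr (_%:R).
  (* Twisted conjugation by [y] takes the roots of [x] to the roots of [x ^ y]. *)
  have inj_f : injective (fun p => y^-1 * p * y ^ u)%g by apply: inj_comp (mulIg _) (mulgI _).
  rewrite /N -[RHS](card_imset _ inj_f); apply: eq_card => q.
  have E p : (y^-1 * p * y ^ u * (y^-1 * p * y ^ u) ^ u = (p * p ^ u) ^ y)%g.
    have uV : (u^-1 = u)%g by apply/eqP; rewrite eq_invg_mul uu.
    by rewrite !conjgE !mulgA !mulgK -[LHS]mulgA uu mulg1 uV.
  apply/idP/imsetP => [|[p]]; rewrite !inE => /andP[Gq /eqP Dq].
    have K v : (y^-1 * (y * q * v^-1) * v = q)%g.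
      by rewrite !mulgA mulVg mul1g mulgKV.
    exists (y * q * (y ^ u)^-1)%g; last by rewrite K.
    rewrite inE !groupM ?groupV ?memJ_norm //=; apply/eqP/(conjg_inj y).
    by rewrite -E K.
  by move=> ->; rewrite (E p) Dq eqxx andbT groupM ?memJ_norm // groupM ?groupV.
pose phi := Cfun 0 Nclass.
have phiE : phi = \sum_i 'chi_i.
  rewrite [phi]cfun_sum_cfdot; apply: eq_bigr => i _.
  suff ->: '[phi, 'chi_i] = 1 by rewrite scale1r.
  have nzG : #|G|%:R != 0 :> algC by rewrite pnatr_eq0 -lt0n cardG_gt0.
  rewrite cfdotE -[RHS](mulVf nzG); congr (_ * _).
  have irrG : mx_irreducible 'Chi_i by apply: socle_irr.
  rewrite -[RHS]conjC_nat -(twisted_indicator irrG) irrRepr rmorph_sum /=.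
  transitivity (\sum_(x in G) \sum_(p in G | (p * p ^ u == x)%g) ('chi_i x)^*).
    apply: eq_bigr => x Gx; rewrite cfunE Gx mulr1n sumr_const -[RHS]mulr_natl.
    by congr (_%:R * _); apply: eq_card => p; rewrite !inE.
  rewrite (exchange_big_dep (fun p => p \in G)) /=; last by move=> x p _ /andP[].
  apply: eq_bigr => p Gp.
  rewrite (big_pred1 (p * p ^ u)%g) // => x /=.
  by rewrite Gp eq_sym andb_idl // => /eqP->; rewrite groupM ?memJ_norm.
by have := congr1 (fun f : 'CF(G) => f g) phiE; rewrite cfunE Gg sum_cfunE => <-.
Qed.
End Model.

End TwistedFrobeniusSchur.

(** * The group G(r,1,n) and its chain of stabilisers *)

Definition sh r n (d : colour r) (x : colour r * 'I_n) : colour r * 'I_n :=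
  (x.1 + d, x.2).

Definition col r n (g : {perm colour r * 'I_n}) (i : 'I_n) : colour r :=
  (g (0, i)).1.

Lemma ordS_add1 r (c : colour r) : ordS c = c + inZp 1.
Proof. by apply: val_inj; rewrite /= modnDmr addn1. Qed.

Lemma sh0 r n (x : colour r * 'I_n) : sh 0 x = x.
Proof. by case: x => c i; rewrite /sh /= addr0. Qed.

Lemma shD r n d e (x : colour r * 'I_n) : sh d (sh e x) = sh (e + d) x.
Proof. by rewrite /sh /= addrA. Qed.

Lemma cshiftE r n (x : colour r * 'I_n) : cshift r n x = sh (inZp 1) x.
Proof. by rewrite permE /shift_fun /sh ordS_add1. Qed.

Lemma cshiftX r n k (x : colour r * 'I_n) : (cshift r n ^+ k)%g x = sh (inZp k) x.
Proof.
elim: k => [|k IH]; first by rewrite expg0 perm1 (_ : inZp 0 = 0) ?sh0 //; apply: val_inj.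
rewrite expgSr permM IH cshiftE shD; congr (sh _ x).
by apply: val_inj; rewrite /= modnDm addn1.
Qed.

Lemma GrnP r n (g : {perm colour r * 'I_n}) :
  reflect (forall d x, g (sh d x) = sh d (g x)) (g \in Grn r n).
Proof.
apply: (iffP cent1P) => [cg d x|gsh].
  have := commuteX d cg => /permP/(_ x); rewrite !permM !cshiftX.
  by rewrite valZpK => ->.
by apply/permP=> x; rewrite !permM !cshiftE gsh.
Qed.

Lemma GrnE r n (g : {perm colour r * 'I_n}) c i : g \in Grn r n ->
  g (c, i) = (c + col g i, pos g i).
Proof.
move=> /GrnP gsh; have ->: (c, i) = sh c (0, i) by rewrite /sh /= add0r.
by rewrite gsh /sh /col /pos addrC.
Qed.

Lemma pos_inj r n (g : {perm colour r * 'I_n}) : g \in Grn r n -> injective (pos g).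
Proof.
move=> Gg i j Eij; have: g (col g j, i) = g (col g i, j).
  by rewrite !GrnE // Eij addrC.
by move/perm_inj => [].
Qed.

Lemma pos1 r n (i : 'I_n) : pos (1%g : {perm colour r * 'I_n}) i = i.
Proof. by rewrite /pos perm1. Qed.

Lemma posM r n (g h : {perm colour r * 'I_n}) i : g \in Grn r n -> h \in Grn r n ->
  pos (g * h)%g i = pos h (pos g i).
Proof. by move=> Gg Gh; rewrite {1}/pos permM [g _]GrnE // GrnE. Qed.

Lemma posX r n (g : {perm colour r * 'I_n}) a i : g \in Grn r n ->
  pos (g ^+ a)%g i = iter a (pos g) i.
Proof.
move=> Gg; elim: a => [|a IH]; first by rewrite expg0 pos1.
by rewrite expgSr posM ?groupX // IH.
Qed.

Lemma snd_perm r n (g : {perm colour r * 'I_n}) x : g \in Grn r n ->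
  (g x).2 = pos g x.2.
Proof. by case: x => c i Gg; rewrite GrnE. Qed.

Lemma snd_permX r n (g : {perm colour r * 'I_n}) a x : g \in Grn r n ->
  ((g ^+ a)%g x).2 = iter a (pos g) x.2.
Proof. by move=> Gg; rewrite snd_perm ?groupX // posX. Qed.

Lemma GrnX_sh r n (g : {perm colour r * 'I_n}) a d x : g \in Grn r n ->
  (g ^+ a)%g (sh d x) = sh d ((g ^+ a)%g x).
Proof. by move=> Gg; apply: GrnP; rewrite groupX. Qed.

Definition neg_fun r n (x : colour r * 'I_n) : colour r * 'I_n := (- x.1, x.2).

Lemma neg_fun_inj r n : injective (@neg_fun r n).
Proof.
move=> [c i] [d j] H; have E2 : i = j := congr1 snd H.
by have /oppr_inj-> : - c = - d := congr1 fst H; rewrite E2.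
Qed.

Definition cneg r n : {perm colour r * 'I_n} := perm (@neg_fun_inj r n).

Lemma cnegE r n (x : colour r * 'I_n) : cneg r n x = (- x.1, x.2).
Proof. by rewrite permE. Qed.

Lemma cneg2 r n : (cneg r n * cneg r n = 1)%g.
Proof. by apply/permP=> x; rewrite permM !cnegE perm1 /= opprK; case: x. Qed.

Lemma cnegV r n : ((cneg r n)^-1 = cneg r n)%g.
Proof. by apply/eqP; rewrite eq_invg_mul cneg2. Qed.

Lemma conj_cnegE r n (g : {perm colour r * 'I_n}) x :
  (g ^ cneg r n)%g x = cneg r n (g (cneg r n x)).
Proof. by rewrite conjgE cnegV !permM. Qed.

Lemma cneg_sh r n d (x : colour r * 'I_n) : cneg r n (sh d x) = sh (- d) (cneg r n x).
Proof. by rewrite !cnegE /sh /= opprD. Qed.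

Lemma cneg_norm r n : cneg r n \in 'N(Grn r n)%g.
Proof.
rewrite inE; apply/subsetP=> _ /imsetP[g /GrnP gsh ->].
by apply/GrnP=> d x; rewrite !conj_cnegE cneg_sh gsh cneg_sh opprK.
Qed.

Notation cstar := (star (cneg _ _)).

(** Inversion turns the gain [d] around the loop into [- d], and negating colours turns it back. *)
Lemma star_loop r n (w : {perm colour r * 'I_n}) j d : w \in Grn r n ->
  w (0, j) = (d, j) -> cstar w (0, j) = (d, j).
Proof.
move=> Gw Ew; have GV : (w^-1)%g \in Grn r n by rewrite groupV.
have {}Ew : (w^-1)%g (0, j) = (- d, j).
  apply: (@perm_inj _ w); rewrite permKV (_ : (- d, j) = sh (- d) (0, j)); last first.
    by rewrite /sh /= add0r.
  by move/GrnP: Gw => ->; rewrite Ew /sh /= subrr.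
by rewrite /star conj_cnegE !cnegE /= oppr0 Ew opprK.
Qed.

(* A map prescribed on one point of each cycle extends along [f] and the
   colour shift, the latter being twisted by [tw]. *)
Lemma orbit_ext r n n' (f : {perm colour r * 'I_n}) (f' : {perm colour r * 'I_n'})
    (D : {pred 'I_n}) (rep : 'I_n -> 'I_n) (tgt : 'I_n -> colour r * 'I_n')
    (tw : colour r -> colour r) :
    f \in Grn r n -> f' \in Grn r n' -> {morph tw : x y / x - y} ->
    (forall i, i \in D -> fconnect (pos f) (rep i) i) ->
    (forall i, i \in D -> (pos f i \in D) && (rep (pos f i) == rep i)) ->
    (forall i, i \in D -> rep i \in D) ->
    (forall i a d, i \in D -> (f ^+ a)%g (0, rep i) = (d, rep i) ->
       (f' ^+ a)%g (tgt (rep i)) = sh (tw d) (tgt (rep i))) ->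
  exists h : colour r * 'I_n -> colour r * 'I_n', forall a c i, i \in D ->
    h ((f ^+ a)%g (c, rep i)) = (f' ^+ a)%g (sh (tw c) (tgt (rep i))).
Proof.
move=> Gf Gf' twB R1 R2 R3 hyp.
pose e a i := (((f ^+ a)%g (0, i)).1 : colour r).
have E a c i : (f ^+ a)%g (c, i) = (c + e a i, iter a (pos f) i).
  by rewrite GrnE ?groupX // posX.
(* Walk back along [f] to the representative in [findex] steps, apply the prescription, and walk
   forward along [f']. *)
exists (fun x => let j := rep x.2 in let a := findex (pos f) j x.2 in
   (f' ^+ a)%g (sh (tw (x.1 - e a j)) (tgt j))) => a c i Di.
rewrite E /=; set j := rep i; set i' := iter a _ _.
have Dj : j \in D by apply: R3.
have inv b k : k \in D -> (iter b (pos f) k \in D) /\ rep (iter b (pos f) k) = rep k.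
  move=> Dk; elim: b => [|b [Db IH]] //=.
  by have /andP[Db' /eqP->] := R2 _ Db.
have rj : rep j = j.
  have /iter_findex := R1 _ Di; rewrite -/j => Ei.
  by have := (inv (findex (pos f) j i) _ Dj).2; rewrite Ei.
have [Di' rj'] := inv a _ Dj; rewrite -/i' rj in Di' rj'; rewrite rj'.
have := R1 _ Di'; rewrite rj' => /iter_findex; set a' := findex _ _ _ => Ea'.
(* [a2] stands for [a - a']: [M] is a multiple of both orders, so adding [a' * M] to an exponent
   changes no power of [f] or [f']. *)
pose M := (#[f]%g * #[f']%g)%N; pose a2 := (a + a' * M.-1)%N.
have M_gt0 : (0 < M)%N by rewrite muln_gt0 !order_gt0.
have EM : (a2 + a' = a + a' * M)%N by rewrite /a2; nia.
have fM : (f ^+ (a' * M) = 1)%g.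
  by apply/eqP; rewrite -order_dvdn dvdn_mull // dvdn_mulr.
have fM' : (f' ^+ (a' * M) = 1)%g.
  by apply/eqP; rewrite -order_dvdn dvdn_mull // dvdn_mull.
have E2 : (f ^+ a2)%g (0, j) = (e a j - e a' j, j).
  apply: (@perm_inj _ (f ^+ a')%g); rewrite -permM -expgD EM expgD fM mulg1 !E.
  by rewrite Ea' add0r subrK.
have := hyp _ _ _ Di E2; rewrite -/j => E3.
have {E3} : (f' ^+ a)%g (tgt j) = (f' ^+ a')%g (sh (tw (e a j - e a' j)) (tgt j)).
  by rewrite -E3 -permM -expgD EM expgD fM' mulg1.
rewrite !GrnX_sh // => ->; rewrite !shD; congr (sh _ _).
by rewrite -[c + _ - _]addrA -[e a j - _]opprB twB opprB !twB opprB addrC.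
Qed.

Lemma cover_cycle r n (g : {perm colour r * 'I_n}) c i j : g \in Grn r n ->
  fconnect (pos g) j i -> exists a c', (c, i) = (g ^+ a)%g (c', j).
Proof.
move=> Gg /iter_findex; set a := findex _ _ _ => Ea.
exists a, (c - col (g ^+ a)%g j).
by rewrite GrnE ?groupX // subrK posX // Ea.
Qed.

Lemma fconnect_pos_sym r n (g : {perm colour r * 'I_n}) : g \in Grn r n ->
  connect_sym (frel (pos g)).
Proof. by move=> Gg; apply/fconnect_sym/pos_inj. Qed.

Lemma starX (gT : finGroupType) (u g : gT) a : star u (g ^+ a)%g = (star u g ^+ a)%g.
Proof. by rewrite /star -expgVn conjXg. Qed.

Lemma cstar_Grn r n (g : {perm colour r * 'I_n}) : g \in Grn r n -> cstar g \in Grn r n.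
Proof. by move=> Gg; rewrite mem_star ?cneg_norm. Qed.

(** On positions [cstar g] acts as [g^-1], which has the same cycles. *)
Lemma fconnect_cstar r n (g : {perm colour r * 'I_n}) : g \in Grn r n ->
  fconnect (pos (cstar g)) =2 fconnect (pos g).
Proof.
move=> Gg i j; rewrite -(same_fconnect_finv (pos_inj Gg)); apply: eq_fconnect => {}i.
apply: (pos_inj Gg); rewrite (f_finv (pos_inj Gg)).
have ->: pos (cstar g) i = pos (g^-1)%g i.
  by rewrite /pos /star conj_cnegE !cnegE /= oppr0.
by rewrite -posM ?groupV // mulVg pos1.
Qed.

Definition Hstab r n k : {group {perm colour r * 'I_n}} :=
  'C_(Grn r n)([set x : colour r * 'I_n | (k <= x.2)%N] | 'P)%G.

Lemma HstabP r n k (g : {perm colour r * 'I_n}) :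
  reflect (g \in Grn r n /\ forall c (i : 'I_n), (k <= i)%N -> g (c, i) = (c, i))
    (g \in Hstab r n k).
Proof.
apply: (iffP setIP) => [[Gg /astabP fg] | [Gg fg]]; split=> //.
  by move=> c i ki; apply: fg; rewrite inE.
by apply/astabP=> [[c i]]; rewrite inE => ki; apply: fg.
Qed.

Lemma cneg_norm_Hstab r n k : cneg r n \in 'N(Hstab r n k)%g.
Proof.
rewrite inE; apply/subsetP=> _ /imsetP[g /HstabP[Gg fg] ->].
apply/HstabP; split; first by rewrite memJ_norm ?cneg_norm.
by move=> c i ki; rewrite conj_cnegE !cnegE fg //= opprK.
Qed.

(* On the cycle of [j], the conjugating element sends [u (0, j)] to
   [cstar u (0, j)] for [u] generated by [g] and the shift; this is well defined
   by [star_loop], and choosing [j = k] on the cycle of [k] keeps [k] fixed. *)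
Lemma Hstab_star_conj r n (k : 'I_n) (g : {perm colour r * 'I_n}) :
  g \in Hstab r n k.+1 -> exists2 h, h \in Hstab r n k & (g ^ h)%g = cstar g.
Proof.
move=> /HstabP[Gg fg]; pose g' := cstar g; have Gg' := cstar_Grn Gg.
have sym := fconnect_pos_sym Gg.
pose rep i := if fconnect (pos g) k i then k else froot (pos g) i.
have rep1 i : fconnect (pos g) (rep i) i.
  by rewrite /rep; case: ifP => // _; rewrite sym connect_root.
have rep2 i j : fconnect (pos g) i j -> rep i = rep j.
  move=> ij; rewrite /rep (same_connect_r sym ij).
  by case: ifP => // _; apply/eqP; rewrite root_connect.
have [h hE] : exists h, forall a c i, i \in predT ->
    h ((g ^+ a)%g (c, rep i)) = (g' ^+ a)%g (sh c (0, rep i)).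
  apply: (@orbit_ext r n n g g' predT rep (fun j => (0, j)) id) => // i.
    by move=> _; rewrite inE -(rep2 i) ?fconnect1 ?eqxx.
  move=> a d _ /star_loop; rewrite starX -/g' => -> //; last by rewrite groupX.
  by rewrite /sh /= add0r.
have [h' hE'] : exists h, forall a c i, i \in predT ->
    h ((g' ^+ a)%g (c, rep i)) = (g ^+ a)%g (sh c (0, rep i)).
  apply: (@orbit_ext r n n g' g predT rep (fun j => (0, j)) id) => // i.
  - by move=> _; rewrite fconnect_cstar.
  - by move=> _; rewrite inE -(rep2 i) ?eqxx // -fconnect_cstar ?fconnect1.
  move=> a d _ /star_loop; rewrite starX starK ?cneg2 // => -> //; last by rewrite groupX.
  by rewrite /sh /= add0r.
have sE c i : sh c (0, i) = (c, i) :> colour r * 'I_n by rewrite /sh /= add0r.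
have zE z : exists a c, z = (g ^+ a)%g (c, rep z.2).
  by case: z => c i; apply: cover_cycle (rep1 i).
have hK : cancel h h'.
  by move=> z; have [a [c ->]] := zE z; rewrite hE // sE hE' // sE.
pose p := perm (can_inj hK).
have hsh d x : h (sh d x) = sh d (h x).
  have [a [c ->]] := zE x; rewrite -GrnX_sh // [sh d (c, _)]/sh /= !hE // -GrnX_sh //.
  by rewrite shD.
(* Positions above [k] are fixed by [g], so each is alone in its cycle. *)
have fixed (i : 'I_n) : (k <= i)%N -> rep i = i.
  rewrite leq_eqVlt => /predU1P[/val_inj<-|ki]; first by rewrite /rep connect0.
  have pi : pos g i = i by rewrite /pos fg.
  have ci j : fconnect (pos g) i j -> j = i.
    by move/iter_findex <-; elim: (findex _ _ _) => //= b ->.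
  rewrite /rep; case: ifP => [|_]; first by rewrite sym => /ci.
  by apply: ci; apply: connect_root.
exists p.
  apply/HstabP; split; first by apply/GrnP=> d x; rewrite !permE hsh.
  move=> c i ki; rewrite permE -{1}(fixed i ki).
  by have := hE 0%N c i isT; rewrite !expg0 !perm1 sE => ->; rewrite fixed.
rewrite -/g'; apply: (mulgI p); rewrite -conjgC.
have pE y : p y = h y by rewrite permE.
apply/permP=> z; rewrite permM [RHS]permM !pE; have [a [c ->]] := zE z.
have gS (f : {perm colour r * 'I_n}) y : f ((f ^+ a)%g y) = (f ^+ a.+1)%g y.
  by rewrite expgSr permM.
by rewrite gS !hE // gS.
Qed.

Lemma Grn_has_rank1 r n : has_rank1_star (cneg r n) (Grn r n).
Proof.
have HT : Hstab r n n = Grn r n.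
  apply/val_inj/setP=> g; apply/HstabP/idP => [[]|Gg] //; split=> // c i.
  by rewrite leqNgt ltn_ord.
rewrite -HT; suff: forall k, (k <= n)%N -> has_rank1_star (cneg r n) (Hstab r n k) by exact.
elim=> [|k IH] kn.
  have ->: Hstab r n 0 = 1%G; last exact: has_rank1_star1.
  apply/val_inj/setP=> g; apply/HstabP/set1gP => [[_ fg]|->]; last first.
    by split=> [|c i _]; rewrite ?group1 ?perm1.
  by apply/permP=> [[c i]]; rewrite fg ?perm1.
apply: has_rank1_star_ext (IH (ltnW kn)); rewrite ?cneg2 ?cneg_norm_Hstab //.
  by apply/subsetP=> g /HstabP[Gg fg]; apply/HstabP; split=> // c i /ltnW; apply: fg.
by move=> g; apply: (@Hstab_star_conj r n (Ordinal kn)).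
Qed.

Lemma Gamma_roots r n (g : {perm colour r * 'I_n}) : g \in Grn r n ->
  Gamma g = #|[set p in Grn r n | (p * p ^ cneg r n == g)%g]|%:R.
Proof.
move=> Gg; apply: sum_irr_twisted_roots => //; rewrite ?cneg2 ?cneg_norm //.
  move=> {Gg}g Gg; case: n g Gg => [|n] g Gg.
    exists 1%g; rewrite ?group1 //; apply/permP=> [[c i]]; by case: i.
  have [|h /HstabP[Gh _] <-] := @Hstab_star_conj r n.+1 ord_max g; last by exists h.
  apply/HstabP; split=> // c i; by rewrite leqNgt ltn_ord.
exact: Grn_has_rank1.
Qed.

(** * Counting twisted square roots *)

Lemma iter_eq_dvd (T : finType) (f : T -> T) x a : injective f ->
  (iter a f x == x) = (fingraph.order f x %| a)%N.
Proof.
move=> injf; set k := fingraph.order f x.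
have k_gt0 : (0 < k)%N by exact: fingraph.order_gt0.
have kq q : iter (q * k) f x = x.
  by elim: q => // q IH; rewrite mulSn iterD IH iter_order.
rewrite {1}(divn_eq a k) addnC iterD kq /dvdn; apply/eqP/eqP => [E|->] //.
by rewrite -(@findex_iter _ f x (a %% k)) ?ltn_pmod // E findex0.
Qed.

(** * Cycles of [g], and the roots supported on a union of cycles *)

Section Cycles.

Variables (r n : nat) (g : {perm colour r * 'I_n}).
Hypothesis Gg : g \in Grn r n.

Definition len (i : 'I_n) := fingraph.order (pos g) i.

(** [cyc_colour] kept as an element of [Z_r], where it can be negated and multiplied. *)
Definition hue (i : 'I_n) : colour r := ((g ^+ len i)%g (0, i)).1.

Definition Cyc (i : 'I_n) : {set 'I_n} := [set j | fconnect (pos g) i j].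

Lemma shE c (i : 'I_n) : (c, i) = sh c (0, i) :> colour r * 'I_n.
Proof. by rewrite /sh /= add0r. Qed.

Lemma sh_inj (x : colour r * 'I_n) : injective (fun d => sh d x).
Proof. by move=> d e /(congr1 fst) /= /addrI. Qed.

Lemma len_gt0 i : (0 < len i)%N.
Proof. exact: fingraph.order_gt0. Qed.

Lemma loop_len x : (g ^+ len x.2)%g x = sh (hue x.2) x.
Proof.
case: x => c i; rewrite shE GrnX_sh //= [in RHS]/sh /=; rewrite /sh /=.
have ->: ((g ^+ len i)%g (0, i)).2 = i by rewrite snd_permX //= iter_order //; apply: pos_inj.
by rewrite -/(hue i) add0r addrC.
Qed.

Lemma loopE x q : (g ^+ (len x.2 * q))%g x = sh (hue x.2 *+ q) x.
Proof.
elim: q => [|q IH]; first by rewrite muln0 expg0 perm1 mulr0n sh0.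
by rewrite mulnS expgD permM loop_len GrnX_sh // IH shD mulrS addrC.
Qed.

(** Returning to a position takes a whole number of turns, each adding the colour of the cycle. This
    is the test for twisted maps to be well defined. *)
Lemma loop_inv x a d : (g ^+ a)%g x = sh d x ->
  (len x.2 %| a)%N /\ d = hue x.2 *+ (a %/ len x.2).
Proof.
move=> E; have dv : (len x.2 %| a)%N.
  by rewrite /len -iter_eq_dvd; [rewrite -snd_permX // E | apply: pos_inj].
split=> //; apply: (@sh_inj x); rewrite -E -loopE mulnC divnK //.
Qed.

Lemma mem_Cyc i : i \in Cyc i.
Proof. by rewrite inE. Qed.

Lemma Cyc_eq i j : j \in Cyc i -> Cyc j = Cyc i.
Proof.
rewrite inE => ij; apply/setP=> k; rewrite !inE.
by rewrite (same_connect (fconnect_pos_sym Gg) ij).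
Qed.

Lemma card_Cyc i : #|Cyc i| = len i.
Proof. by apply: eq_card => j; rewrite inE. Qed.

Lemma len_Cyc i j : j \in Cyc i -> len j = len i.
Proof. by move/Cyc_eq=> E; rewrite -!card_Cyc E. Qed.

Lemma pos_Cyc i j : (pos g j \in Cyc i) = (j \in Cyc i).
Proof.
rewrite !inE; apply/idP/idP => H.
  by rewrite (same_connect_r (fconnect_pos_sym Gg) (fconnect1 (pos g) j)).
by apply: connect_trans H _; apply: fconnect1.
Qed.

Lemma cover_pt (x z : colour r * 'I_n) : z.2 \in Cyc x.2 ->
  exists a c, z = sh c ((g ^+ a)%g x).
Proof.
case: z => c i; rewrite inE => /(cover_cycle c Gg)[a [c' ->]].
exists a, (c' - x.1); rewrite -GrnX_sh //; congr (_ _).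
by rewrite /sh addrC subrK.
Qed.

Lemma hue_Cyc i j : j \in Cyc i -> hue j = hue i.
Proof.
move=> ij; have [a [c E]] := @cover_pt (0, i) (0, j) ij.
have := loop_len (0, j); rewrite (len_Cyc ij) E GrnX_sh // -permM -expgD addnC expgD permM.
have /= -> := loop_len (0, i); rewrite GrnX_sh // !shD [c + _]addrC => /sh_inj/addIr ->; congr hue.
by have := congr1 snd E.
Qed.

Definition stable (D : {set 'I_n}) := forall i, (pos g i \in D) = (i \in D).

Lemma stableX (D : {set 'I_n}) a x : stable D -> (((g ^+ a)%g x).2 \in D) = (x.2 \in D).
Proof.
by move=> sD; rewrite snd_permX //; elim: a => //= a <-; rewrite sD.
Qed.

Lemma stable_Cyc i : stable (Cyc i). Proof. exact: pos_Cyc. Qed.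

Lemma stableU D E : stable D -> stable E -> stable (D :|: E).
Proof. by move=> sD sE i; rewrite !inE sD sE. Qed.

Lemma stableD D E : stable D -> stable E -> stable (D :\: E).
Proof. by move=> sD sE i; rewrite !inE sD sE. Qed.

Lemma sub_Cyc D i : stable D -> i \in D -> Cyc i \subset D.
Proof.
move=> sD iD; apply/subsetP=> j; rewrite inE => /iter_findex <-.
by elim: (findex _ _ _) => //= a; rewrite sD.
Qed.

(* Twisted square roots of [g] supported on the positions in [D]. *)
Definition roots (D : {set 'I_n}) : {set {perm colour r * 'I_n}} :=
  [set th | perm_on [set x | x.2 \in D] th &
     [forall x : colour r * 'I_n, (x.2 \in D) ==> (th (th x) == g x) &&
       [forall d, th (sh d x) == sh (- d) (th x)]]].

Lemma rootsP (D : {set 'I_n}) (th : {perm colour r * 'I_n}) : reflect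
  [/\ forall x, x.2 \notin D -> th x = x,
      forall x, x.2 \in D -> (th x).2 \in D,
      forall x, x.2 \in D -> th (th x) = g x &
      forall d x, x.2 \in D -> th (sh d x) = sh (- d) (th x)] (th \in roots D).
Proof.
rewrite inE; apply: (iffP andP) => [[on /forallP H]|[H1 H2 H3 H4]]; split.
- by move=> x xD; apply: (out_perm on); rewrite inE.
- by move=> x xD; have := perm_closed x on; rewrite !inE => ->.
- by move=> x xD; have := H x; rewrite xD => /andP[/eqP].
- by move=> d x xD; have := H x; rewrite xD => /andP[_ /forallP/(_ d)/eqP].
- by apply/subsetP=> x; rewrite inE; apply: contraR => xD; rewrite H1 // -in_setC inE.
apply/forallP=> x; apply/implyP=> xD; rewrite H3 // eqxx.
by apply/forallP=> d; rewrite H4.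
Qed.

Lemma roots_gX (D : {set 'I_n}) (th : {perm colour r * 'I_n}) a x :
  stable D -> th \in roots D -> x.2 \in D ->
  th ((g ^+ a)%g x) = (g ^+ a)%g (th x).
Proof.
move=> sD /rootsP[H1 H2 H3 H4]; elim: a x => [|a IH] x xD; first by rewrite !expg0 !perm1.
rewrite !expgS !permM IH; last by rewrite snd_perm // sD.
by rewrite -!H3 // H2.
Qed.

(** For [th = p * cneg r n] the equation reads [th * th = g], and commuting with the shift becomes
    inverting it. *)
Lemma card_roots_setT :
  #|[set p in Grn r n | (p * p ^ cneg r n == g)%g]| = #|roots setT|.
Proof.
rewrite -(card_imset _ (mulIg (cneg r n))); apply: eq_card => th.
apply/imsetP/rootsP => [[p]|[_ _ H3 H4]].
  rewrite inE => /andP[/GrnP psh /eqP Ep] ->; split=> [x|x|x _|d x _]; rewrite ?inE //.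
    by rewrite -Ep conjgE cnegV !permM.
  by rewrite !permM psh cneg_sh.
exists (th * cneg r n)%g; last by rewrite -mulgA cneg2 mulg1.
rewrite inE; apply/andP; split.
  by apply/GrnP=> d x; rewrite !permM H4 ?inE // cneg_sh opprK.
apply/eqP/permP=> x; rewrite conjgE cnegV !permM.
have K z : cneg r n (cneg r n z) = z by rewrite -permM cneg2 perm1.
by rewrite !K H3 ?inE.
Qed.

(** Left multiplication by [th1], which moves only points over [E], is a bijection from the roots on
    the remaining positions. *)
Lemma card_roots_split D E th1 : stable D -> stable E -> E \subset D ->
    th1 \in roots E ->
  #|[set th in roots D | [forall x : colour r * 'I_n, (x.2 \in E) ==> (th x == th1 x)]]|
    = #|roots (D :\: E)|.
Proof.
move=> sD sE ED /rootsP[A1 A2 A3 A4].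
rewrite -[RHS](card_imset _ (mulgI th1)); apply: eq_card => th.
have A2V z : z.2 \in E -> ((th1^-1)%g z).2 \in E.
  move=> zE; apply/negPn/negP=> nE; have zz := A1 _ nE.
  by rewrite permKV in zz; rewrite -zz zE in nE.
have A1V z : z.2 \notin E -> (th1^-1)%g z = z.
  by move=> zE; apply: (@perm_inj _ th1); rewrite permKV A1.
apply/idP/imsetP => [|[th' /rootsP[B1 B2 B3 B4] ->]].
  rewrite inE => /andP[/rootsP[H1 H2 H3 H4] /forallP ag].
  have {}ag z : z.2 \in E -> th z = th1 z by move=> zE; have := ag z; rewrite zE => /eqP.
  exists (th1^-1 * th)%g; last by rewrite mulKVg.
  (* Points over [E] already take all values over [E], so by injectivity no other point lands
     there. *)
  have out z : z.2 \in D :\: E -> (th z).2 \in D :\: E.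
    rewrite !inE => /andP[zE zD]; rewrite H2 // andbT; apply: contra zE => tE.
    suff <-: (th1^-1)%g (th z) = z by apply: A2V.
    by apply: (@perm_inj _ th); rewrite ag ?A2V // permKV.
  apply/rootsP; split=> [z|z zD|z zD|d z zD]; rewrite ?permM.
  - rewrite !inE negb_and negbK => /orP[zE|zD].
      by rewrite ag ?A2V // permKV.
    by have zE : z.2 \notin E by [apply: contra zD; apply: (subsetP ED)]; rewrite A1V // H1.
  - by have := zD; rewrite inE => /andP[zE _]; rewrite A1V // out.
  - have := zD; rewrite inE => /andP[zE zD']; rewrite A1V // A1V ?H3 //.
    by have := out _ zD; rewrite inE => /andP[].
  by have := zD; rewrite inE => /andP[zE zD']; rewrite !A1V // H4.
have out z : z.2 \in E -> th' z = z by move=> zE; rewrite B1 // inE zE.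
rewrite inE; apply/andP; split; last first.
  by apply/forallP=> z; apply/implyP=> zE; rewrite permM out // A2.
apply/rootsP; split=> [z zD|z zD|z zD|d z zD]; rewrite !permM.
- have zE : z.2 \notin E by apply: contra zD; apply: (subsetP ED).
  by rewrite A1 // B1 // inE zE (negPf zD).
- have [zE|zE] := boolP (z.2 \in E); first by rewrite out ?A2 // (subsetP ED) // A2.
  rewrite A1 //; have: (th' z).2 \in D :\: E by rewrite B2 // inE zE.
  by rewrite inE => /andP[].
- have [zE|zE] := boolP (z.2 \in E); first by rewrite !out ?A2 // A3.
  have zDE : z.2 \in D :\: E by rewrite inE zE.
  rewrite (A1 z) // (A1 (th' z)) ?B3 //.
  by have := B2 _ zDE; rewrite inE => /andP[].
have [zE|zE] := boolP (z.2 \in E); first by rewrite !out ?A2 // A4.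
by rewrite !A1 // B4 // inE zE.
Qed.

Lemma roots_restr (D E : {set 'I_n}) (th : {perm colour r * 'I_n}) :
  stable D -> stable E -> E \subset D -> th \in roots D ->
  (forall x, x.2 \in E -> (th x).2 \in E) ->
  exists2 th1, th1 \in roots E & forall x, x.2 \in E -> th1 x = th x.
Proof.
move=> sD sE /subsetP ED /rootsP[H1 H2 H3 H4] HE.
pose S := [set x : colour r * 'I_n | x.2 \in E].
have nS : th \in 'N(S | 'P)%g.
  by rewrite !inE; apply/subsetP=> x; rewrite !inE; apply: HE.
have rE x : x.2 \in E -> restr_perm S th x = th x.
  by move=> xE; rewrite restr_permE // inE.
exists (restr_perm S th) => //; apply/rootsP; split=> [x xE|x xE|x xE|d x xE].
- by rewrite (out_perm (restr_perm_on S th)) // inE.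
- by rewrite rE // HE.
- by rewrite !rE ?HE // H3 // ED.
by rewrite !rE // H4 // ED.
Qed.

(** Injectivity comes from [h (h z) = g z]; outside [E] the map is completed by the identity. *)
Lemma roots_build (E : {set 'I_n}) (h : colour r * 'I_n -> colour r * 'I_n) : stable E ->
    (forall z, z.2 \in E -> (h z).2 \in E) ->
    (forall z, z.2 \in E -> h (h z) = g z) ->
    (forall d z, z.2 \in E -> h (sh d z) = sh (- d) (h z)) ->
  exists2 th, th \in roots E & forall z, z.2 \in E -> th z = h z.
Proof.
move=> sE H1 H2 H3; pose h1 z := if z.2 \in E then h z else z.
have h1_inj : injective h1.
  move=> z w; rewrite /h1; have [zE|zE] := ifPn; have [wE|wE] := ifPn => // Ezw.
  - by apply: (@perm_inj _ g); rewrite -!H2 // Ezw.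
  - by rewrite -Ezw H1 in wE.
  by rewrite Ezw H1 in zE.
have pE z : perm h1_inj z = if z.2 \in E then h z else z by rewrite permE.
exists (perm h1_inj) => [|z zE]; last by rewrite pE zE.
apply/rootsP; split=> [z zE|z zE|z zE|d z zE]; rewrite ?pE /= ?(negPf zE) ?zE ?H1 //.
- exact: H2.
exact: H3.
Qed.

(** Commuting with [g] and inverting the shift propagates the value at [x] along its cycle; squaring
    to [g] gives the value at [th1 x], hence the second cycle. *)
Lemma roots_agree (D E : {set 'I_n}) (th1 th2 : {perm colour r * 'I_n}) x : stable D -> stable E ->
    th1 \in roots D -> th2 \in roots E -> x.2 \in D -> x.2 \in E ->
    th1 x = th2 x ->
  forall z, z.2 \in Cyc x.2 :|: Cyc (th1 x).2 -> th1 z = th2 z.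
Proof.
move=> sD sE R1 R2 xD xE E12; case/rootsP: (R1) => A1 A2 A3 A4.
case/rootsP: (R2) => B1 B2 B3 B4.
have key w z : w.2 \in D -> w.2 \in E -> th1 w = th2 w -> z.2 \in Cyc w.2 -> th1 z = th2 z.
  move=> wD wE Ew /cover_pt[a [c ->]].
  by rewrite A4 ?B4 ?stableX // (roots_gX a sD) // (roots_gX a sE) // Ew.
move=> z; rewrite inE => /orP[]; first exact: key.
apply: key; rewrite ?A2 //; first by rewrite E12 B2.
by rewrite A3 // E12 B3.
Qed.

(** By [roots_agree] at most one such root exists, so this boolean, read as 0 or 1, counts them. *)
Definition valid x y :=
  [exists th in roots (Cyc x.2 :|: Cyc y.2), th x == y].

(** A root sending [x] to [y] preserves the union [E] of the two cycles and is unique there; the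
    only freedom left is a root on [D :\: E]. *)
Lemma card_roots_pt D (x y : colour r * 'I_n) : stable D -> x.2 \in D -> y.2 \in D ->
  #|[set th in roots D | th x == y]| =
    (valid x y * #|roots (D :\: (Cyc x.2 :|: Cyc y.2))|)%N.
Proof.
move=> sD xD yD; set E := _ :|: _.
have sE : stable E by apply: stableU; apply: stable_Cyc.
have ED : E \subset D by rewrite subUset !sub_Cyc.
have xE : x.2 \in E by rewrite inE mem_Cyc.
have yE : y.2 \in E by rewrite inE mem_Cyc orbT.
have [/exists_inP[th1 R1 /eqP th1x]|nv] := boolP (valid x y).
  rewrite mul1n -(card_roots_split sD sE ED R1); apply: eq_card => th.
  apply/setIdP/setIdP => -[Rth H]; split=> //; last first.
    by move/forallP/(_ x): H; rewrite xE th1x.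
  move/eqP: H => thx; apply/forallP=> z; apply/implyP=> zE; apply/eqP.
  by apply: (roots_agree sD sE Rth R1 xD xE); rewrite ?thx ?th1x.
rewrite mul0n; apply/eqP; rewrite cards_eq0; apply: contraNT nv => /set0Pn[th].
case/setIdP=> Rth /eqP thx; case/rootsP: (Rth) => A1 A2 A3 A4.
have HE z : z.2 \in E -> (th z).2 \in E.
  have key w : w.2 \in E -> (th w).2 \in E -> forall z, z.2 \in Cyc w.2 -> (th z).2 \in E.
    move=> wE tE z' /cover_pt[a [c ->]]; have wD := subsetP ED _ wE.
    by rewrite A4 ?stableX //= (roots_gX a sD) // stableX.
  rewrite inE => /orP[]; apply: key => //; rewrite ?thx //.
  by rewrite -thx A3 // snd_perm // sE.
have [th1 R1 E1] := roots_restr sD sE ED Rth HE.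
by apply/exists_inP; exists th1; rewrite // E1 // thx.
Qed.

Lemma card_roots_rec D (x : colour r * 'I_n) : stable D -> x.2 \in D ->
  #|roots D| = \sum_(y : colour r * 'I_n | y.2 \in D)
     (valid x y * #|roots (D :\: (Cyc x.2 :|: Cyc y.2))|)%N.
Proof.
move=> sD xD; rewrite -sum1_card.
rewrite (partition_big (fun th : {perm colour r * 'I_n} => th x)
  (fun y => y.2 \in D)) /=; last first.
  by move=> th /rootsP[_ H2 _ _]; apply: H2.
apply: eq_bigr => y yD; rewrite -card_roots_pt // -sum1_card.
by apply: eq_bigl => th; rewrite inE.
Qed.

End Cycles.

(** * Which images a point can have under a root *)

Section Validity.

Variables (r n : nat) (g : {perm colour r * 'I_n}).
Hypothesis Gg : g \in Grn r n.

Local Notation Cyc := (Cyc g).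
Local Notation len := (len g).
Local Notation hue := (hue g).
Implicit Types x y z : colour r * 'I_n.

(** Serves for [y] on or off the cycle of [x]; if the cycles coincide, the hypotheses demand that
    the two formulas describe one map. *)
Lemma validI x y (h : colour r * 'I_n -> colour r * 'I_n) :
    (forall c a, h (sh c ((g ^+ a)%g x)) = sh (- c) ((g ^+ a)%g y)) ->
    (forall c a, h (sh c ((g ^+ a)%g y)) = sh (- c) ((g ^+ a)%g (g x))) ->
  valid g x y.
Proof.
move=> Hx Hy; set E := Cyc x.2 :|: Cyc y.2.
have sE : stable g E by apply: stableU; apply: stable_Cyc.
have xE : x.2 \in E by rewrite inE mem_Cyc.
have yE : y.2 \in E by rewrite inE mem_Cyc orbT.
have zP z : z.2 \in E -> exists a c, z = sh c ((g ^+ a)%g x) \/ z = sh c ((g ^+ a)%g y).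
  by rewrite inE => /orP[] /(cover_pt Gg)[a [c Ez]]; exists a, c; [left|right].
have gS a w : g ((g ^+ a)%g w) = (g ^+ a)%g (g w) by rewrite -!permM -expgS expgSr.
have /GrnP gsh := Gg.
have [z zE|z zE|d z zE|th Rth thE] := @roots_build r n g E h sE.
- have [a [c [->|->]]] := zP _ zE; rewrite ?Hx ?Hy /= stableX // snd_perm ?sE //.
- have [a [c [->|->]]] := zP _ zE; rewrite !(Hx, Hy) ?gS -?[(g ^+ a)%g (g x)]gS.
    by rewrite opprK gsh.
  by rewrite -permM -expgSr Hx opprK expgSr permM gsh.
- by have [a [c [->|->]]] := zP _ zE; rewrite shD ?Hx ?Hy shD opprD.
apply/exists_inP; exists th => //; apply/eqP; rewrite thE //.
by have := Hx 0 0%N; rewrite oppr0 !sh0 expg0 !perm1.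
Qed.

(** A root carries the loop at [x] to a loop at [y] with negated colour; carrying the loop at [y] to
    [g x] gives the reverse divisibility of lengths. *)
Lemma valid_type x y : valid g x y -> len y.2 = len x.2 /\ hue y.2 = - hue x.2.
Proof.
case/exists_inP=> th; set E := _ :|: _ => Rth /eqP thx.
have sE : stable g E by apply: stableU; apply: stable_Cyc.
have xE : x.2 \in E by rewrite inE mem_Cyc.
have yE : y.2 \in E by rewrite inE mem_Cyc orbT.
case/rootsP: (Rth) => A1 A2 A3 A4.
have [dyx E1] : (len y.2 %| len x.2)%N /\ - hue x.2 = hue y.2 *+ (len x.2 %/ len y.2).
  by apply: loop_inv => //; rewrite -thx -(roots_gX Gg _ sE) // loop_len // A4.
have [dxy _] : (len (g x).2 %| len y.2)%N /\ - hue y.2 = hue (g x).2 *+ (len y.2 %/ len (g x).2).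
  by apply: loop_inv => //; rewrite -A3 // thx -(roots_gX Gg _ sE) // loop_len // A4.
have E2 : len y.2 = len x.2.
  apply/eqP; rewrite eqn_dvd dyx /=; move: dxy.
  by rewrite (len_Cyc Gg (i := x.2)) // snd_perm // pos_Cyc // mem_Cyc.
by rewrite E1 E2 divnn len_gt0.
Qed.

Lemma valid_out x y : y.2 \notin Cyc x.2 ->
  valid g x y = (len y.2 == len x.2) && (hue y.2 == - hue x.2).
Proof.
move=> yx; apply/idP/andP => [/valid_type[-> ->]|[/eqP El /eqP Eh]]; first by rewrite !eqxx.
pose E := Cyc x.2 :|: Cyc y.2.
pose rep i := if i \in Cyc x.2 then x.2 else y.2.
(* Squaring to [g] forces [y] to go to [g x]. The shifts by [x.1] and [y.1] account for base points
   taken at colour 0. *)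
pose tgt j := if j == x.2 then sh x.1 y else sh y.1 (g x).
have xE : x.2 \in E by rewrite inE mem_Cyc.
have yE : y.2 \in E by rewrite inE mem_Cyc orbT.
have nyx : (y.2 == x.2) = false.
  by apply: contraNF yx => /eqP->; apply: mem_Cyc.
have [a b|i|i|i|i a d|h hE] := @orbit_ext r n n g g (mem E) rep tgt -%R Gg Gg.
- by rewrite opprD.
- rewrite -[i \in mem E]/(i \in E) in_setU /rep.
  by case: ifP => [ix _|_ /= iy]; [rewrite inE in ix | rewrite inE in iy].
- rewrite -[pos g i \in mem E]/(pos g i \in E) -[i \in mem E]/(i \in E) /rep.
  by rewrite pos_Cyc // eqxx andbT !in_setU !pos_Cyc.
- by rewrite /rep => _; case: ifP.
- move=> iE; rewrite /rep; case: ifP => _.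
    have ->: (d, x.2) = sh d (0, x.2) by rewrite -shE.
    case/(loop_inv Gg) => /= dv ->; rewrite /tgt eqxx GrnX_sh // shD addrC -shD; congr (sh _ _).
    by rewrite -{1}(divnK dv) mulnC -El loopE // Eh mulNrn.
  have ->: (d, y.2) = sh d (0, y.2) by rewrite -shE.
  case/(loop_inv Gg) => /= dv ->; rewrite /tgt nyx GrnX_sh // shD addrC -shD; congr (sh _ _).
  have [Lx Hx] : len (g x).2 = len x.2 /\ hue (g x).2 = hue x.2.
    by rewrite (len_Cyc Gg (i := x.2)) ?(hue_Cyc Gg (i := x.2)) // snd_perm // pos_Cyc // mem_Cyc.
  by rewrite -{1}(divnK dv) mulnC El -Lx loopE // Hx Eh mulNrn opprK.
have rx : rep x.2 = x.2 by rewrite /rep mem_Cyc.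
have ry : rep y.2 = y.2 by rewrite /rep (negPf yx).
apply: (@validI _ _ h) => c a; rewrite -GrnX_sh //.
  have := hE a (x.1 + c) _ xE; rewrite rx => ->.
  by rewrite /tgt eqxx shD -GrnX_sh // opprD addrA subrr add0r.
have := hE a (y.1 + c) _ yE; rewrite ry => ->.
by rewrite /tgt nyx shD -GrnX_sh // opprD addrA subrr add0r.
Qed.

(** If [y = sh e (g ^+ b x)], the shifts cancel in the square and [g ^+ (2 b)] agrees with [g] at
    [x]. So [2 b - 1] is [q] times the length: both are odd, [b] is determined modulo the length,
    and the colour, killed by [q] and by 2, is 0. *)
Lemma valid_in x y : y.2 \in Cyc x.2 ->
  valid g x y = [&& odd (len x.2), hue x.2 == 0 &
                    [exists e, y == sh e ((g ^+ (len x.2).+1./2)%g x)]].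
Proof.
move=> yx; set k := len x.2; set b0 := (k.+1)./2.
have k_gt0 : (0 < k)%N by apply: len_gt0.
apply/idP/and3P => [v|[kodd /eqP hx0 /existsP[e /eqP Ey]]].
  have [_ hy] := valid_type v; rewrite (hue_Cyc Gg yx) in hy.
  case/exists_inP: v => th; set E := _ :|: _ => Rth /eqP thx.
  have sE : stable g E by apply: stableU; apply: stable_Cyc.
  have xE : x.2 \in E by rewrite inE mem_Cyc.
  case/rootsP: (Rth) => A1 A2 A3 A4.
  have [b1 [e Ey]] := cover_pt Gg yx.
  (* The same power of [g], with an exponent large enough for the natural-number subtractions
     below. *)
  pose b := (b1 + #[g]%g * k)%N.
  have {}Ey : y = sh e ((g ^+ b)%g x).
    by rewrite Ey /b expgD expgM expg_order expg1n mulg1.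
  have b_ge : (k <= b)%N.
    by rewrite /b (leq_trans _ (leq_addl _ _)) // leq_pmull ?order_gt0.
  have E2 : (g ^+ (b + b))%g x = g x.
    rewrite -A3 // thx Ey A4 ?stableX // (roots_gX Gg _ sE) // thx Ey GrnX_sh //.
    by rewrite shD subrr sh0 -permM -expgD.
  have [dv E3] : (k %| (b + b).-1)%N /\ 0 = hue x.2 *+ ((b + b).-1 %/ k).
    apply: loop_inv => //; rewrite sh0; apply: (@perm_inj _ g).
    have Eb : (b + b = (b + b).-1.+1)%N by lia.
    by rewrite -E2 [in RHS]Eb expgSr permM.
  have kodd : odd k.
    by case/dvdnP: dv => q Eq; have: odd (q * k) by [rewrite -Eq; lia]; rewrite oddM => /andP[].
  have hx0 : hue x.2 = 0.
    case/dvdnP: dv => q Eq; move: E3; rewrite Eq mulnK //.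
    have qodd : odd q by have: odd (q * k) by [rewrite -Eq; lia]; rewrite oddM => /andP[].
    have h2 : hue x.2 *+ 2 = 0 by rewrite mulr2n {1}hy addNr.
    by rewrite -(odd_double_half q) qodd mulrSr -muln2 mulnC mulrnA h2 mul0rn add0r.
  split=> //; first by rewrite hx0.
  apply/existsP; exists e; rewrite {1}Ey; apply/eqP; congr (sh _ _).
  have b0E : (b0 + b0 = k.+1)%N by rewrite addnn /b0 -[RHS]odd_double_half /= kodd.
  have b0le : (b0 <= b)%N by lia.
  have : (k %| b - b0)%N.
    rewrite -(@Gauss_dvdr k 2); last by rewrite coprime_sym coprime2n.
    have ->: (2 * (b - b0) = (b + b).-1 - k)%N by lia.
    by rewrite dvdn_sub.
  case/dvdnP=> q Eq; rewrite -(subnK b0le) Eq expgD permM mulnC loopE //.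
  by rewrite hx0 mul0rn sh0.
have b0E : (b0 + b0 = k.+1)%N by rewrite addnn /b0 -[RHS]odd_double_half /= kodd.
pose tgt (j : 'I_n) := sh x.1 y.
have xE : x.2 \in Cyc x.2 by rewrite mem_Cyc.
have [a b|i|i|i|i a d|h hE] := @orbit_ext r n n g g (mem (Cyc x.2)) (fun _ => x.2) tgt -%R Gg Gg.
- by rewrite opprD.
- by rewrite inE.
- by move=> iE; rewrite eqxx andbT [_ \in _]pos_Cyc.
- by [].
- move=> _; have ->: (d, x.2) = sh d (0, x.2) by rewrite -shE.
  case/(loop_inv Gg) => /= dv ->; rewrite hx0 mul0rn oppr0 sh0 /tgt GrnX_sh //; congr (sh _ _).
  by rewrite -(divnK dv) mulnC -(len_Cyc Gg yx) loopE // (hue_Cyc Gg yx) hx0 mul0rn sh0.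
have Hx c a : h (sh c ((g ^+ a)%g x)) = sh (- c) ((g ^+ a)%g y).
  rewrite -GrnX_sh //; have := hE a (x.1 + c) _ xE => ->.
  by rewrite /tgt shD -GrnX_sh // opprD addrA subrr add0r.
apply: (@validI _ _ h) => // c a.
have gD a' b' w : (g ^+ a')%g ((g ^+ b')%g w) = (g ^+ (b' + a'))%g w.
  by rewrite expgD permM.
rewrite {1}Ey GrnX_sh // shD gD Hx {1}Ey GrnX_sh // shD gD.
rewrite opprD addrA subrr add0r; congr (sh _ _).
by rewrite addnA b0E expgD permM expgSr permM loop_len // hx0 sh0.
Qed.

End Validity.

(* Involutions of [m] points, weighted by [a] per fixed point and [b] per pair. *)
Fixpoint matchw (a b m : nat) : nat :=
  match m with
  | 0 => 1
  | p.+1 => match p with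
            | 0 => a
            | q.+1 => (a * matchw a b p + p * b * matchw a b q)%N
            end
  end.

Lemma matchwS a b m :
  matchw a b m.+1 = (a * matchw a b m + m * b * matchw a b m.-1)%N.
Proof. by case: m => [|m] //=; rewrite muln1 mul0n mul0n addn0. Qed.

(** Bijections between [p] and [q] points, weighted by [b] per matched pair. *)
Definition bijw (b p q : nat) : nat := if p == q then (p`! * b ^ p)%N else 0.

Lemma bijwC b p q : bijw b p q = bijw b q p.
Proof. by rewrite /bijw eq_sym; case: eqP => // ->. Qed.

Lemma bijwS b p q : bijw b p.+1 q = (q * b * bijw b p q.-1)%N.
Proof.
case: q => [|q]; rewrite /bijw ?mul0n //= eqSS; case: eqP => [->|_]; last by rewrite muln0.
by rewrite factS expnS mulnACA.
Qed.

(** * The expected root count of a cycle type, and its recursion *)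

Section Weight.

Variable r : nat.

Definition fixw (t : colour r) (k : nat) : nat :=
  if odd k && (t == 0) then r.-1.+1 else 0.

(* The pair of opposite colours [t], [- t] is accounted for once, at its
   smaller member. *)
Definition tfac (m : colour r -> nat -> nat) (k : nat) (t : colour r) : nat :=
  let b := (r.-1.+1 * k)%N in
  if t == - t then matchw (fixw t k) b (m t k)
  else if (val t < val (- t))%N then bijw b (m t k) (m (- t) k) else 1.

Definition weight (N : nat) (m : colour r -> nat -> nat) : nat :=
  (\prod_(1 <= k < N.+1) \prod_(t : colour r) tfac m k t)%N.

Lemma eq_weight N m m' : (forall t k, m t k = m' t k) -> weight N m = weight N m'.
Proof.
by move=> E; apply: eq_bigr => k _; apply: eq_bigr => t _; rewrite /tfac !E.
Qed.

Lemma weight0 N m : (forall t k, m t k = 0%N) -> weight N m = 1%N.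
Proof.
move=> E; apply: big1 => k _; apply: big1 => t _; rewrite /tfac !E /bijw /=.
by do 2![case: ifP => // _].
Qed.

(** The distinguished cycle is either stabilised or matched with one of the [m' (- t) k] candidates.
    The truncated subtraction is harmless: its coefficient vanishes when there is no candidate. *)
Lemma weight_rec N (m m' : colour r -> nat -> nat) t k : (0 < k <= N)%N ->
    (forall t' k', m t' k' = (m' t' k' + ((t' == t) && (k' == k)))%N) ->
  weight N m = (fixw t k * weight N m' + m' (- t) k * (r.-1.+1 * k) *
    weight N (fun t' k' => m' t' k' - ((t' == - t) && (k' == k)))%N)%N.
Proof.
move=> kN Em; set m2 := (fun t' k' => _); set b := (r.-1.+1 * k)%N.
(* The member of [{t, - t}] at which [tfac] records the pair; all other factors, gathered in [K],
   are unaffected. *)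
pose u := if (t == - t) || (val t < val (- t))%N then t else - t.
pose K := ((\prod_(t' : colour r | t' != u) tfac m' k t') *
  \prod_(1 <= k' < N.+1 | k' != k) \prod_(t' : colour r) tfac m' k' t')%N.
have wE m0 : (forall t' k', ~~ ((k' == k) && ((t' == t) || (t' == - t))) -> m0 t' k' = m' t' k') ->
    weight N m0 = (tfac m0 k u * K)%N.
  move=> E; rewrite /weight (bigD1_seq k) ?iota_uniq ?mem_index_iota //=.
  rewrite (bigD1 u) //= /K mulnA; congr (_ * _ * _)%N.
    apply: eq_bigr => t' t'u; rewrite /tfac.
    have [t't|t't] := boolP ((t' == t) || (t' == - t)); last first.
      have E1 : m0 t' k = m' t' k by apply: E; rewrite eqxx.
      have E2 : m0 (- t') k = m' (- t') k.
        by apply: E; rewrite eqxx eqr_oppLR eqr_opp orbC.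
      by rewrite E1 E2.
    move: t't t'u; rewrite /u; case: ifP => [/orP[/eqP tt|lt]|] .
    - by rewrite -tt orbb => ->.
    - case/orP=> /eqP->; first by rewrite eqxx.
      by rewrite opprK eq_sym => /negPf->; rewrite ltnNge (ltnW lt).
    move/negbT; rewrite negb_or => /andP[/negPf ntt nlt].
    by case/orP=> /eqP->; rewrite ?eqxx // ntt (negPf nlt).
  apply: eq_bigr => k' k'k; apply: eq_bigr => t' _.
  by rewrite /tfac !E // (negPf k'k).
rewrite (wE m) => [|t' k']; last by rewrite Em; case: (_ == t); case: (_ == k); rewrite ?addn0.
rewrite (wE m') // (wE m2) => [|t' k']; last first.
  by rewrite /m2; case: (_ == - t); case: (_ == k); rewrite ?subn0 ?orbT.
suff ->: tfac m k u = (fixw t k * tfac m' k u + m' (- t) k * b * tfac m2 k u)%N.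
  by rewrite mulnDl !mulnA.
have mt : m t k = (m' t k).+1 by rewrite Em !eqxx addn1.
have m2t : m2 (- t) k = (m' (- t) k).-1 by rewrite /m2 !eqxx subn1.
rewrite /tfac -/b /u; case: (boolP (t == - t)) => [/eqP tt|ntt].
  have m2t' : m2 t k = (m' t k).-1 by rewrite /m2 -tt !eqxx subn1.
  by rewrite orTb -!tt eqxx mt matchwS m2t'.
rewrite orFb.
have -> : fixw t k = 0%N.
  have /negPf nt0 : t != 0 by apply: contra ntt => /eqP->; rewrite oppr0.
  by rewrite /fixw nt0 andbF.
have m1 : m (- t) k = m' (- t) k.
  by rewrite Em eq_sym (negPf ntt) addn0.
have m2s : m2 t k = m' t k by rewrite /m2 (negPf ntt) subn0.
rewrite mul0n add0n; case: (boolP (val t < val (- t))%N) => lt.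
  by rewrite (negPf ntt) lt mt m1 m2t m2s bijwS.
rewrite opprK eq_sym (negPf ntt).
have ->: (val (- t) < val t)%N.
  by rewrite ltn_neqAle leqNgt (negPf lt) andbT; apply: contra ntt => /eqP/val_inj->.
by rewrite mt m1 m2t m2s bijwC bijwS bijwC.
Qed.

End Weight.

(** * Counting roots from cycle multiplicities *)

Section CountRoots.

Variables (r n : nat) (g : {perm colour r * 'I_n}).
Hypothesis Gg : g \in Grn r n.

Local Notation Cyc := (Cyc g).
Local Notation len := (len g).
Local Notation hue := (hue g).
Local Notation stable := (stable g).

Definition npos (D : {set 'I_n}) (t : colour r) (k : nat) : nat :=
  #|[set i in D | (hue i == t) && (len i == k)]|.

(** Counting positions and dividing by the length avoids handling sets of cycles; the division is
    exact on stable sets by [npos_mD]. *)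
Definition mD D t k := (npos D t k %/ k)%N.

Lemma npos_rm D j t k : stable D -> j \in D ->
  npos D t k = (npos (D :\: Cyc j) t k + ((hue j == t) && (len j == k)) * k)%N.
Proof.
move=> sD jD; rewrite /npos -(cardsID (Cyc j)) addnC; congr (_ + _)%N.
  by apply: eq_card => i; rewrite !inE andbA.
have [/andP[/eqP ht /eqP lk]|nm] := boolP (_ && _).
  rewrite mul1n -[RHS]lk -[RHS](card_Cyc g); apply: eq_card => i; rewrite in_setI inE.
  apply: andb_idl => ij; rewrite (subsetP (sub_Cyc sD jD)) //.
  by rewrite (hue_Cyc Gg ij) (len_Cyc Gg ij) ht lk !eqxx.
rewrite mul0n; apply: eq_card0 => i; rewrite in_setI inE; apply: contraNF nm.
by case/andP=> /andP[_ H] ij; rewrite -(hue_Cyc Gg ij) -(len_Cyc Gg ij).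
Qed.

Lemma mD_rm D j t k : stable D -> j \in D ->
  mD D t k = (mD (D :\: Cyc j) t k + ((hue j == t) && (len j == k)))%N.
Proof.
move=> sD jD; rewrite /mD (npos_rm _ _ sD jD).
case: (boolP (_ && _)) => [/andP[_ /eqP lk]|_]; last by rewrite mul0n !addn0.
by rewrite mul1n -lk divnDr ?dvdnn // divnn len_gt0.
Qed.

Lemma card_rm D j : stable D -> j \in D -> (#|D :\: Cyc j| < #|D|)%N.
Proof.
move=> sD jD; apply/proper_card/properP.
by split; [apply: subsetDl | exists j; rewrite // inE mem_Cyc].
Qed.

Lemma npos_mD D t k : stable D -> npos D t k = (k * mD D t k)%N.
Proof.
have [N] := ubnP #|D|; elim: N D => // N IH D /ltnSE leN sD.
have [->|[j jD]] := set_0Vmem D.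
  rewrite /mD (_ : npos _ _ _ = 0%N) ?div0n ?muln0 //.
  by apply: eq_card0 => i; rewrite !inE.
rewrite (npos_rm _ _ sD jD) (mD_rm _ _ sD jD) mulnDr mulnC -IH 1?mulnC //.
  exact: leq_trans (card_rm sD jD) leN.
exact/stableD/stable_Cyc.
Qed.

Lemma sum_valid_in (x : colour r * 'I_n) :
  (\sum_(y : colour r * 'I_n | y.2 \in Cyc x.2) valid g x y)%N = fixw (hue x.2) (len x.2).
Proof.
under eq_bigr => y yx do rewrite (valid_in Gg yx) andbA.
rewrite /fixw; case: ifP => _; last by rewrite big1.
set w := (g ^+ _)%g x; rewrite -[RHS](card_ord r.-1.+1) -(card_imset _ (@sh_inj r n w)).
rewrite -sum1_card big_mkcond [RHS]big_mkcond; apply: eq_bigr => y _ /=.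
have ->: [exists e, y == sh e w] = (y \in [set sh e w | e in 'I_r.-1.+1]).
  by apply/existsP/imsetP => [[e /eqP->]|[e _ ->]]; exists e.
case: imsetP => [[e _ ->]|_]; last by case: ifP.
by rewrite stableX ?mem_Cyc //; apply: stable_Cyc.
Qed.

Lemma card_roots D : stable D -> #|roots g D| = weight n (mD D).
Proof.
have [N] := ubnP #|D|; elim: N D => // N IH D /ltnSE leN sD.
have [D0|[j jD]] := set_0Vmem D.
  rewrite D0 weight0 => [|t k]; last first.
    rewrite /mD /npos (_ : [set i in _ | _] = set0) ?cards0 ?div0n //.
    by apply/setP=> i; rewrite !inE.
  rewrite -(cards1 (1%g : {perm colour r * 'I_n})); apply: eq_card => th.
  apply/rootsP/set1P => [[H _ _ _]|->].
    by apply/permP=> z; rewrite perm1 H ?inE.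
  by split=> [x|x|x|d x]; rewrite ?inE ?perm1.
pose x : colour r * 'I_n := (0, j).
set D' := D :\: Cyc j.
have sD' : stable D' by apply/stableD/stable_Cyc.
have ltD' : (#|D'| < N)%N by apply: leq_trans (card_rm sD jD) leN.
set t := hue j; set k := len j.
have kn : (0 < k <= n)%N.
  by rewrite len_gt0 /= /k -card_Cyc -[X in (_ <= X)%N]card_ord max_card.
rewrite (weight_rec (m' := mD D') (t := t) (k := k) kn); last first.
  by move=> t' k'; rewrite (mD_rm _ _ sD jD) (eq_sym t') (eq_sym k').
rewrite (card_roots_rec Gg (x := x) sD jD) (bigID (fun y : colour r * 'I_n => y.2 \in Cyc j)) /=.
congr (_ + _)%N.
  rewrite -(sum_valid_in x) /= -(IH D') // big_distrl /=.
  apply: eq_big => [y|y /andP[_ yj]].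
    by rewrite andb_idl // => /(subsetP (sub_Cyc sD jD)).
  by rewrite (Cyc_eq Gg yj) setUid.
(* Off the cycle of [x], the admissible [y] lie over cycles of colour [- t] and length [k], each
   carrying [r k] points and leaving the same type behind. *)
transitivity (\sum_(y : colour r * 'I_n | (y.2 \in D') && ((hue y.2 == - t) && (len y.2 == k)))
   weight n (fun t' k' => mD D' t' k' - ((t' == - t) && (k' == k)))%N)%N.
  rewrite [RHS]big_mkcondr /=; apply: eq_big => [y|y /andP[yD yj]].
    by rewrite in_setD andbC.
  rewrite (valid_out Gg (x := x) yj) /= andbC.
  case: ifP => [/andP[/eqP hy /eqP ly]|_]; last by rewrite mul0n.
  have yD' : y.2 \in D' by rewrite in_setD yj.
  rewrite mul1n -setDDl; set D2 := D' :\: Cyc y.2.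
  have sD2 : stable D2 by apply/stableD/stable_Cyc.
  rewrite IH //; last by apply: leq_trans (card_rm sD' yD') (ltnW ltD').
  apply: eq_weight => t' k'; rewrite (mD_rm _ _ sD' yD') -/D2 hy ly (eq_sym t') (eq_sym k').
  by rewrite addnK.
rewrite sum_nat_const; congr (_ * _)%N.
rewrite mulnCA [X in (_ * X)%N]mulnC -(npos_mD _ _ sD') /npos.
transitivity #|setX [set: colour r] [set i in D' | (hue i == - t) && (len i == k)]|.
  by apply: eq_card => -[c i]; rewrite in_setX in_setT in_set.
by rewrite cardsX cardsT card_ord.
Qed.

End CountRoots.

Lemma Gamma_weight r n (g : {perm colour r * 'I_n}) : g \in Grn r n ->
  Gamma g = (weight n (mD g setT))%:R.
Proof.
by move=> Gg; rewrite Gamma_roots // card_roots_setT // card_roots // => i; rewrite !inE.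
Qed.

(** * Conjugacy classes and cycle types *)

(** The cycles of this colour and length partition their positions into blocks of size [k]. *)
Lemma mult_mD r n (g : {perm colour r * 'I_n}) (t : colour r) k : g \in Grn r n ->
  mult g t k = mD g setT t k.
Proof.
move=> Gg; have sT : stable g setT by move=> i; rewrite !inE.
have [->|k_gt0] := posnP k.
  rewrite /mD divn0; apply: eq_card0 => C; apply/negbTE/imsetP => -[i].
  by rewrite inE => /andP[/eqP E _]; have := len_gt0 g i; rewrite /len E.
pose S := [set i | (hue g i == t) && (len g i == k)].
have SE : #|S| = npos g setT t k by apply: eq_card => i; rewrite !inE.
have memS i : ((fingraph.order (pos g) i == k) && (cyc_colour g i == val t)) = (i \in S).
  by rewrite inE andbC.
have eqR : {in S & &, equivalence_rel (fconnect (pos g))}.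
  move=> x y z _ _ _; split=> [|xy]; first exact: connect0.
  exact: same_connect (fconnect_pos_sym Gg) _ _ xy _.
have CE i : i \in S -> Cyc g i = [set j in S | fconnect (pos g) i j].
  move=> iS; apply/setP=> j; apply/idP/setIdP => [ij|[_ ij]]; last by rewrite inE.
  split; last by rewrite inE in ij.
  by move: iS; rewrite !inE (hue_Cyc Gg ij) (len_Cyc Gg ij).
have cE : cycles_of_type g t k = equivalence_partition (fconnect (pos g)) S.
  apply/setP=> C; apply/imsetP/imsetP => -[i].
    by rewrite inE memS => iS ->; exists i; rewrite // -CE.
  by move=> iS ->; exists i; rewrite ?inE ?memS // -CE.
have := card_uniform_partition (n := k) _ (equivalence_partitionP eqR).
rewrite -cE -/(mult g t k) SE (npos_mD Gg) // => H.
apply/eqP; rewrite -(eqn_pmul2r k_gt0) -H ?[(mD _ _ _ _ * _)%N]mulnC // => C.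
case/imsetP=> i; rewrite inE memS => iS ->.
by rewrite -/(Cyc g i) card_Cyc; move: iS; rewrite inE => /andP[_ /eqP].
Qed.

Lemma loop_type r n n' (g : {perm colour r * 'I_n}) (g' : {perm colour r * 'I_n'}) x x' :
    g \in Grn r n -> g' \in Grn r n' ->
    (forall a d, (g ^+ a)%g x = sh d x <-> (g' ^+ a)%g x' = sh d x') ->
  len g x.2 = len g' x'.2 /\ hue g x.2 = hue g' x'.2.
Proof.
move=> Gg Gg' E.
have [d1 E1] := loop_inv Gg' ((E _ _).1 (loop_len Gg x)).
have [d2 E2] := loop_inv Gg ((E _ _).2 (loop_len Gg' x')).
have El : len g x.2 = len g' x'.2 by apply/eqP; rewrite eqn_dvd d1 d2.
by split=> //; rewrite E1 El divnn len_gt0.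
Qed.

Lemma npos_conj r n (g h : {perm colour r * 'I_n}) t k : g \in Grn r n -> h \in Grn r n ->
  npos (g ^ h)%g setT t k = npos g setT t k.
Proof.
move=> Gg Gh; have Ggh : (g ^ h)%g \in Grn r n by rewrite groupJ.
rewrite /npos -[RHS](card_imset _ (pos_inj Gh)).
have type i : len g i = len (g ^ h)%g (pos h i) /\ hue g i = hue (g ^ h)%g (pos h i).
  apply: (@loop_type r n n g (g ^ h)%g (0, i) (h (0, i))) => // a d.
  have /GrnP hsh := Gh.
  rewrite -conjXg -hsh -permM -conjgC permM; split=> [->|/perm_inj] //.
have onto : forall i, exists j, i = pos h j.
  by move=> i; exists (invF (pos_inj Gh) i); rewrite f_invF.
apply: eq_card => i; have [j ->] := onto i; have [El Eh] := type j.
by rewrite (mem_imset _ _ (pos_inj Gh)) !inE /= -El -Eh.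
Qed.

(** Cycles of equal type are matched by their rank in the enumerations of the two sets of cycles,
    and a choice of base points is extended by [orbit_ext]. *)
Lemma conj_of_mD r n (g g' : {perm colour r * 'I_n}) : g \in Grn r n -> g' \in Grn r n ->
    (forall t k, mD g setT t k = mD g' setT t k) ->
  exists2 h, h \in Grn r n & (g ^ h)%g = g'.
Proof.
move=> Gg Gg' Em; have sym := fconnect_pos_sym Gg.
pose L (f : {perm colour r * 'I_n}) j := enum (cycles_of_type f (hue g j) (len g j)).
pose beta j := nth set0 (L g' j) (index (Cyc g j) (L g j)).
pose tau j := odflt j [pick j' | Cyc g' j' == beta j].
have memL f j i : f \in Grn r n -> hue f i = hue g j -> len f i = len g j -> Cyc f i \in L f j.
  move=> Gf Eh El; rewrite mem_enum; apply/imsetP; exists i => //.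
  by rewrite inE -/(len f i) El eqxx /= -Eh.
have LP f j C : f \in Grn r n -> C \in L f j ->
    exists i, [/\ C = Cyc f i, hue f i = hue g j & len f i = len g j].
  move=> Gf; rewrite mem_enum => /imsetP[i]; rewrite inE => /andP[/eqP El /eqP Eh] ->.
  by exists i; split=> //; apply: val_inj.
have sL j : size (L g' j) = size (L g j).
  by rewrite /L -!cardE -/(mult g _ _) -/(mult g' _ _) !mult_mD.
have tauP j : [/\ Cyc g' (tau j) = beta j, hue g' (tau j) = hue g j & len g' (tau j) = len g j].
  have bL : beta j \in L g' j by rewrite mem_nth // sL index_mem memL.
  have [i [Ei Eh El]] := LP _ _ _ Gg' bL.
  rewrite /tau; case: pickP => [j' /eqP Ej'|/(_ i)]; last by rewrite Ei eqxx.
  have ij : j' \in Cyc g' i by rewrite -Ei -Ej' mem_Cyc.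
  by rewrite Ej' /= -Eh -El (hue_Cyc Gg' ij) (len_Cyc Gg' ij).
pose rep := froot (pos g).
have rep1 i : fconnect (pos g) (rep i) i by rewrite sym connect_root.
have rep2 i j : fconnect (pos g) i j -> rep i = rep j.
  by move=> ij; apply/eqP; rewrite root_connect.
have sE n' c (i : 'I_n') : sh c (0, i) = (c, i) :> colour r * 'I_n' by rewrite /sh /= add0r.
have [h hE] : exists h, forall a c i, i \in predT ->
    h ((g ^+ a)%g (c, rep i)) = (g' ^+ a)%g (sh c (0, tau (rep i))).
  apply: (@orbit_ext r n n g g' predT rep (fun j => (0, tau j)) id) => // i.
    by move=> _; rewrite inE -(rep2 i) ?fconnect1 ?eqxx.
  move=> a d _; rewrite -[in (d, _)]sE => /(loop_inv Gg)[/= dv ->].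
  have [_ Eh El] := tauP (rep i).
  by rewrite -{1}(divnK dv) mulnC -El (loopE Gg' (0, _)) /= Eh El.
have zE z : exists a c, z = (g ^+ a)%g (c, rep z.2).
  by case: z => c i; apply: cover_cycle (rep1 i).
have onto z' : exists z, z' = h z.
  case: z' => c' i'.
  have : exists i, [/\ hue g i = hue g' i', len g i = len g' i' & beta i = Cyc g' i'].
    have: (0 < mult g' (hue g' i') (len g' i'))%N.
      by apply/card_gt0P; exists (Cyc g' i'); apply/imsetP; exists i'; rewrite // inE !eqxx.
    rewrite mult_mD // -Em -mult_mD // => /card_gt0P[C0 /imsetP[i0]].
    rewrite inE => /andP[/eqP El0 /eqP/val_inj Eh0] _.
    have iL : Cyc g' i' \in L g' i0 by rewrite memL.
    pose s := index (Cyc g' i') (L g' i0).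
    have sltn : (s < size (L g i0))%N by rewrite -sL index_mem.
    have [i [Ei Eh El]] := LP _ _ _ Gg (mem_nth set0 sltn).
    exists i; split; rewrite ?Eh ?El //.
    rewrite /beta /L Eh El -/(L g' i0) -/(L g i0) -Ei index_uniq ?enum_uniq //.
    exact: nth_index.
  case=> i [Eh El Eb]; have rc : rep i \in Cyc g i by rewrite inE sym.
  have [Et _ _] := tauP (rep i).
  have bE : beta (rep i) = beta i.
    by rewrite /beta /L (hue_Cyc Gg rc) (len_Cyc Gg rc) (Cyc_eq Gg rc).
  have /(cover_cycle c' Gg')[a [c ->]] : fconnect (pos g') (tau (rep i)) i'.
    by have := mem_Cyc g' i'; rewrite -Eb -bE -Et inE.
  by exists ((g ^+ a)%g (c, rep i)); rewrite hE // sE.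
(* A surjection of a finite set onto itself is injective. *)
have h_inj : injective h.
  apply: in2T; apply/image_injP/eqP; apply: eq_card => z'.
  by have [z ->] := onto z'; rewrite image_f.
pose p := perm h_inj.
have pE y : p y = h y by rewrite permE.
have gS (f : {perm colour r * 'I_n}) a y : f ((f ^+ a)%g y) = (f ^+ a.+1)%g y.
  by rewrite expgSr permM.
exists p.
  apply/GrnP=> d x; rewrite !pE; have [a [c ->]] := zE x.
  by rewrite -GrnX_sh // [sh d (c, _)]/sh /= !hE // -GrnX_sh // shD.
apply: (mulgI p); rewrite -conjgC.
apply/permP=> z; rewrite permM [RHS]permM !pE; have [a [c ->]] := zE z.
by rewrite gS !hE // gS.
Qed.

(* A cycle type: [m (t, k)] is the number of cycles of colour [t] and length [k.+1]. *)
Definition ctype r n := {ffun colour r * 'I_n -> 'I_n.+1}.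

Definition csize r n (m : ctype r n) : nat := (\sum_(i : colour r * 'I_n) i.2.+1 * m i)%N.

Definition cext r n (m : ctype r n) (t : colour r) (k : nat) : nat :=
  if k is k'.+1 then if insub k' is Some k'' then val (m (t, k'')) else 0%N else 0%N.

Definition cyctype r n (g : {perm colour r * 'I_n}) : ctype r n :=
  [ffun i : colour r * 'I_n => inord (mD g setT i.1 i.2.+1)].

Lemma len_le r n (g : {perm colour r * 'I_n}) i : (len g i <= n)%N.
Proof. by rewrite -card_Cyc -[X in (_ <= X)%N]card_ord max_card. Qed.

Lemma mD_le r n (g : {perm colour r * 'I_n}) t k : (mD g setT t k <= n)%N.
Proof.
by apply: leq_trans (leq_div _ _) _; rewrite -[X in (_ <= X)%N]card_ord max_card.
Qed.

Lemma cyctypeE r n (g : {perm colour r * 'I_n}) (i : colour r * 'I_n) :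
  cyctype g i = mD g setT i.1 i.2.+1 :> nat.
Proof. by rewrite ffunE inordK // ltnS mD_le. Qed.

Lemma cext_cyctype r n (g : {perm colour r * 'I_n}) t k :
  cext (cyctype g) t k = mD g setT t k.
Proof.
case: k => [|k] /=; first by rewrite /mD divn0.
case: insubP => [k' _ <-|]; first by rewrite cyctypeE.
rewrite -leqNgt => nk; rewrite /mD (_ : npos _ _ _ _ = 0%N) ?div0n //.
apply: eq_card0 => i; rewrite !inE /=; apply/negbTE; rewrite negb_and; apply/orP; right.
by rewrite neq_ltn ltnS (leq_trans (len_le g i) nk).
Qed.

Lemma csize_cyctype r n (g : {perm colour r * 'I_n}) : g \in Grn r n -> csize (cyctype g) = n.
Proof.
move=> Gg; rewrite /csize -[RHS]card_ord -sum1_card.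
have len1 i : ((len g i).-1 < n)%N by rewrite prednK ?len_gt0 ?len_le.
rewrite (partition_big (fun i => (hue g i, Ordinal (len1 i))) xpredT) //=.
apply: eq_bigr => -[t k] _; rewrite cyctypeE -npos_mD => [|//|i]; last by rewrite !inE.
rewrite /npos -sum1_card; apply: eq_bigl => i; rewrite !inE xpair_eqE; congr (_ && _).
by rewrite -val_eqE /= -[in LHS](prednK (len_gt0 g i)) eqSS.
Qed.

(** * An element of prescribed cycle type *)

Section Model.

Variables (r n : nat) (m : ctype r n).
Hypothesis csize_m : csize m = n.

(** A cell is a type, one of its [m i] cycles, and a place on that cycle; as [csize m = n], cells
    can be numbered by ['I_n]. *)
Definition cell := {i : colour r * 'I_n & ('I_(m i) * 'I_(i.2.+1))%type}.

Definition mkcell (i : colour r * 'I_n) (j : 'I_(m i)) (a : 'I_i.2.+1) : cell :=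
  Tagged (fun i => ('I_(m i) * 'I_(i.2.+1))%type) (j, a).

Lemma card_cell : n = #|{: cell}|.
Proof.
rewrite card_tagged sumnE big_map big_enum /= -[LHS]csize_m.
by apply: eq_bigr => i _; rewrite card_prod !card_ord mulnC.
Qed.

Definition cell_of (i : 'I_n) : cell := enum_val (cast_ord card_cell i).
Definition pos_of (p : cell) : 'I_n := cast_ord (esym card_cell) (enum_rank p).

Lemma cell_ofK : cancel cell_of pos_of.
Proof. by move=> i; rewrite /pos_of /cell_of enum_valK cast_ordK. Qed.

Lemma pos_ofK : cancel pos_of cell_of.
Proof. by move=> p; rewrite /pos_of /cell_of cast_ordKV enum_rankK. Qed.

Definition next_cell (p : cell) : cell :=
  mkcell (tagged p).1 (ordS (tagged p).2).

(** The whole colour of a cycle is put on its closing step. *)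
Definition cell_col (p : cell) : colour r :=
  if (tagged p).2 == (tag p).2 :> nat then (tag p).1 else 0.

Lemma next_cell_inj : injective next_cell.
Proof.
apply: (can_inj (g := fun p => mkcell (tagged p).1 (ord_pred (tagged p).2))).
by case=> i [j a]; rewrite /next_cell /mkcell /= ordSK.
Qed.

Definition model_fun (x : colour r * 'I_n) : colour r * 'I_n :=
  (x.1 + cell_col (cell_of x.2), pos_of (next_cell (cell_of x.2))).

Lemma model_fun_inj : injective model_fun.
Proof.
move=> [c i] [d j] H.
have /(can_inj pos_ofK)/next_cell_inj/(can_inj cell_ofK) E : _ = _ := congr1 snd H.
by rewrite /= in E; have := congr1 fst H; rewrite /= E => /addIr->.
Qed.

Definition model : {perm colour r * 'I_n} := perm model_fun_inj.

Lemma model_Grn : model \in Grn r n.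
Proof. by apply/GrnP=> d x; rewrite !permE /model_fun /sh /= addrAC. Qed.

Lemma model_iter i (j : 'I_(m i)) (b : 'I_i.2.+1) c :
  (model ^+ b)%g (c, pos_of (mkcell j ord0)) = (c, pos_of (mkcell j b)).
Proof.
case: b => b /=; elim: b => [|b IH] bi.
  by rewrite expg0 perm1; congr (_, pos_of (mkcell j _)); apply: val_inj.
rewrite expgSr permM (IH (ltnW bi)) permE /model_fun /= pos_ofK /cell_col /=.
have bk : (b < i.2)%N by [].
rewrite (ltn_eqF bk) addr0; congr (_, pos_of _); rewrite /next_cell /=.
by congr mkcell; apply: val_inj; rewrite /= modn_small.
Qed.

Lemma model_type i (j : 'I_(m i)) (a : 'I_i.2.+1) :
  len model (pos_of (mkcell j a)) = i.2.+1 /\ hue model (pos_of (mkcell j a)) = i.1.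
Proof.
have Gm := model_Grn; set x0 := pos_of (mkcell j ord0).
have full : (model ^+ i.2.+1)%g (0, x0) = sh i.1 (0, x0).
  rewrite expgSr permM (model_iter j ord_max) permE /model_fun /= pos_ofK /cell_col /= eqxx.
  by congr (_, pos_of _); rewrite /next_cell /=; congr mkcell; apply: val_inj; rewrite /= modnn.
have [/= dv Eh] := loop_inv Gm full.
(* The loop [full] bounds the length from above; an earlier return would identify two distinct
   cells. *)
have l0 : len model x0 = i.2.+1.
  apply/eqP; rewrite eqn_leq dvdn_leq //= ltnNge; apply/negP => le_l.
  have lt_l : (len model x0 < i.2.+1)%N by rewrite ltnS.
  have := congr1 snd (model_iter j (Ordinal lt_l) 0); rewrite snd_permX //=.
  rewrite iter_order ?pos_inj; last exact: pos_inj.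
  move/(can_inj pos_ofK)/eqP; rewrite /mkcell -tag_eqE /tag_eq eqxx /= tagged_asE.
  by rewrite xpair_eqE => /andP[_ /eqP/(congr1 val) /= E]; have := len_gt0 model x0; rewrite -E.
have mem : pos_of (mkcell j a) \in Cyc model x0.
  rewrite inE; have := congr1 snd (model_iter j a 0); rewrite snd_permX //= => <-.
  exact: fconnect_iter.
by rewrite (len_Cyc Gm mem) (hue_Cyc Gm mem) l0 Eh l0 divnn.
Qed.

Lemma cyctype_model : cyctype model = m.
Proof.
apply/ffunP=> i; apply: val_inj; rewrite [LHS]cyctypeE /mD.
rewrite (_ : npos _ _ _ _ = i.2.+1 * m i)%N ?mulKn //.
rewrite mulnC -[i.2.+1 in RHS]card_ord -[val (m i) in RHS]card_ord -card_prod.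
pose f (q : 'I_(m i) * 'I_i.2.+1) := pos_of (mkcell q.1 q.2).
have f_inj : injective f.
  move=> [j a] [j' a'] /(can_inj pos_ofK)/eqP; rewrite /mkcell -tag_eqE /tag_eq eqxx /=.
  by rewrite tagged_asE => /eqP.
rewrite -(card_codom f_inj); apply: eq_card => x; rewrite inE /= in_setT /=.
apply/idP/codomP => [|[[j a] ->]]; last first.
  by have [-> ->] := model_type j a; rewrite !eqxx.
rewrite -(cell_ofK x); case: (cell_of x) => -[t k] [j a].
have [-> ->] := @model_type (t, k) j a; rewrite eqSS val_eqE => /andP[/eqP Et /eqP Ek].
have Eu : (t, k) = i by rewrite [i]surjective_pairing -Et -Ek.
by subst i; exists (j, a).
Qed.

End Model.

(** Summing over classes, [cyctype] is injective by [conj_of_mD] and reaches every type of size [n]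
    by [model]. *)
Lemma table_sum_ctype r n :
  table_sum (Grn r n) = \sum_(m : ctype r n | csize m == n) (weight n (cext m))%:R.
Proof.
pose ty (xG : {set {perm colour r * 'I_n}}) := cyctype (repr xG).
transitivity (\sum_(xG in classes (Grn r n)) Gamma (repr xG)).
  rewrite /table_sum exchange_big /= reindex_irr_class.
  by apply: eq_bigr => j _; apply: eq_bigr => i _; rewrite mxE.
have Grepr xG : xG \in classes (Grn r n) -> repr xG \in Grn r n.
  by case/repr_classesP.
transitivity (\sum_(m in ty @: classes (Grn r n)) (weight n (cext m))%:R : algC).
  rewrite [RHS]big_imset /=; last first.
    move=> xG yG xc yc; rewrite /ty => E.
    have [||t k|h Gh Eh] := @conj_of_mD r n (repr xG) (repr yG); try exact: Grepr.
      by rewrite -!cext_cyctype E.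
    have [_ ->] := repr_classesP xc; have [_ ->] := repr_classesP yc.
    by rewrite -Eh classGidl.
  apply: eq_bigr => xG xc; rewrite Gamma_weight ?Grepr //; congr (_%:R).
  by apply: eq_weight => t k; rewrite cext_cyctype.
apply: eq_bigl => m; apply/imsetP/eqP => [[xG xc ->]|wm].
  by rewrite csize_cyctype // Grepr.
have Gm := model_Grn wm.
exists (model wm ^: Grn r n)%g; first exact: mem_classes.
rewrite -[LHS](cyctype_model wm); apply/ffunP=> i; apply: val_inj.
rewrite [LHS]cyctypeE [RHS]cyctypeE; have [h Gh ->] := repr_class (Grn r n) (model wm).
by rewrite /mD npos_conj.
Qed.

(** * Generating functions *)

(** Without fixed points only perfect matchings remain. *)
Lemma matchw_Dser b m : (matchw 0 b m)%:R = scomp Dser b%:R 2 m.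
Proof.
have even j : matchw 0 b j.*2 = (dfact j * b ^ j)%N.
  by elim: j => //= j; case: j.*2 => [|p] /= ->; rewrite ?mul0n ?add0n expnS; nia.
have odd_ j : matchw 0 b j.*2.+1 = 0%N.
  by elim: j => // j IH; rewrite doubleS matchwS IH muln0.
rewrite /scomp /= dvdn2 -{1}(odd_double_half m); case: (odd m).
  by rewrite add1n odd_.
by rewrite add0n even divn2 natrM natrX.
Qed.

Lemma ocoefE c m N : (m./2 < N)%N ->
  ocoef c m = \sum_(k < N) ('C(m, k.*2))%:R * (dfact k)%:R * c ^+ k.
Proof.
move=> /subnKC <-; elim: (N - _)%N => [|d IH]; first by rewrite addn0.
by rewrite addnS big_ord_recr /= -IH bin_small ?mul0r ?addr0 //; lia.
Qed.

(** The last of [m + 2] points is either fixed or paired with one of the [m + 1] others, at weight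
    [c]. *)
Lemma ocoefSS c m : ocoef c m.+2 = ocoef c m.+1 + m.+1%:R * c * ocoef c m.
Proof.
(* Zero binomials pad the three sums so that they align term by term after splitting off [k = 0]. *)
have [H0 H1 H2] : [/\ m./2 < m.+2, m.+1./2 < m.+3 & m.+2./2 < m.+3]%N by split; lia.
rewrite (ocoefE _ H2) (ocoefE _ H1) (ocoefE _ H0) !(@big_ord_recl _ _ _ m.+2).
rewrite -[RHS]addrA; congr (_ + _).
rewrite mulr_sumr -big_split /=; apply: eq_bigr => k _; rewrite /bump /= add1n doubleS binS.
have := mul_bin_diag m.+1 k.*2 => /= E.
have {}E : m.+1%:R * 'C(m, k.*2)%:R = k.*2.+1%:R * 'C(m.+1, k.*2.+1)%:R :> algC.
  by rewrite -!natrM E.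
rewrite natrD /= natrM exprS.
transitivity ('C(m.+1, k.*2.+2)%:R * (k.*2.+1%:R * (dfact k)%:R) * (c * c ^+ k) +
  (k.*2.+1%:R * 'C(m.+1, k.*2.+1)%:R) * (dfact k)%:R * c * c ^+ k); first by ring.
by rewrite -E; ring.
Qed.

(** Extracting [a] from every point leaves weight [a k / a^2 = k / a] per pair. *)
Lemma matchw_Rser a k m : (0 < a)%N ->
  (matchw a (a * k) m)%:R = scomp (Rser (k%:R / a%:R)) a%:R 1 m.
Proof.
move=> a_gt0; have nza : a%:R != 0 :> algC by rewrite pnatr_eq0 -lt0n.
rewrite /scomp /= dvd1n divn1 /Rser.
suff [] : (matchw a (a * k) m)%:R = ocoef (k%:R / a%:R) m * a%:R ^+ m /\
  (matchw a (a * k) m.+1)%:R = ocoef (k%:R / a%:R) m.+1 * a%:R ^+ m.+1 by [].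
elim: m => [|m [IH1 IH2]].
  by rewrite /ocoef !big_ord_recl !big_ord0 /= !bin0 !expr0 !mulr1 !addr0 !mul1r expr1.
split=> //; rewrite matchwS natrD !natrM IH1 IH2 ocoefSS !exprS.
by field.
Qed.

(** The exponent [p + p] reflects the identification of the variables of opposite colours. *)
Lemma bijw_Fser b p : (bijw b p p)%:R = scomp Fser b%:R 2 (p + p)%N.
Proof.
rewrite /bijw eqxx /scomp /= addnn dvdn2 odd_double /= divn2 doubleK.
by rewrite natrM natrX.
Qed.

(** Representatives of the colours modulo negation; for positive [r] these are [0, ..., r./2]. *)
Definition half_colour r : pred (colour r) :=
  fun t => (t == - t) || (val t < val (- t))%N.
Arguments half_colour : clear implicits.

Lemma prod_half (R : comNzRingType) r (f : colour r -> R) : (0 < r)%N ->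
  \prod_(t : colour r | half_colour r t) f t =
    f 0 * (if odd r then 1 else f (inZp r./2)) *
    \prod_(1 <= s < ((r - (if odd r then 1 else 2))./2).+1) f (inZp s).
Proof.
move=> r_gt0; pose F s := f (inZp s).
have ->: \prod_(t : colour r | half_colour r t) f t = \prod_(0 <= s < r./2.+1) F s.
  have rE := prednK r_gt0.
  rewrite (big_nat_widen _ _ r.-1.+1); last by rewrite rE; lia.
  rewrite big_mkord; apply: eq_big => [t|t _]; last by rewrite /F valZpK.
  rewrite /half_colour -val_eqE /=; have := ltn_ord t.
  move: (nat_of_ord t) => v; rewrite rE => vr.
  have [->|v_gt0] := posnP v; first by rewrite subn0 modnn.
  by rewrite modn_small; lia.
rewrite big_nat_recl // -mulrA; congr (_ * _).
  by congr f; apply: val_inj; rewrite /= mod0n.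
rewrite big_add1 /=; case: ifP => ro.
  by rewrite mul1r; congr (\prod_(_ <= _ < _) _); lia.
have ->: r./2 = ((r - 2)./2).+1 by lia.
by rewrite big_nat_recr //= mulrC; congr (_ * _); congr f; congr inZp; lia.
Qed.

(** The final formula groups the lengths [2 k] and [2 k - 1] of colour 0; the lengths beyond [n]
    thereby added contribute 1. *)
Lemma prod_even_odd (R : comNzRingType) (f : nat -> R) n :
  (forall k, (n < k)%N -> f k = 1) ->
  \prod_(1 <= k < n.+1) f k = \prod_(1 <= k < n.+1) (f k.*2 * f k.*2.-1).
Proof.
move=> f1; have ->: \prod_(1 <= k < n.+1) (f k.*2 * f k.*2.-1) = \prod_(1 <= k < n.*2.+1) f k.
  elim: (n) => [|p IH]; first by rewrite !big_geq.
  rewrite big_nat_recr //= IH doubleS [RHS]big_nat_recr //= [X in _ = X * _]big_nat_recr //= -mulrA.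
  by congr (_ * _); apply: mulrC.
rewrite [RHS](@big_cat_nat _ _ _ n.+1) //=; last by lia.
rewrite [X in _ = _ * X]big_nat_cond [X in _ = _ * X]big1 ?mulr1 // => k /andP[/andP[nk _] _].
exact: f1.
Qed.

Lemma tfac_out r (m : colour r -> nat -> nat) k t : ~~ half_colour r t -> tfac m k t = 1%N.
Proof. by rewrite /half_colour /tfac negb_or => /andP[/negPf-> /negPf->]. Qed.

Lemma oppZp_half r : (0 < r)%N -> ~~ odd r -> - (inZp r./2 : colour r) = inZp r./2.
Proof.
move=> r_gt0 ro; apply: val_inj; rewrite /= (prednK r_gt0).
by rewrite (@modn_small r./2) ?modn_small; lia.
Qed.

Lemma val_inZp r s : (0 < r)%N -> (s < r)%N -> (inZp s : colour r) = s :> nat.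
Proof. by move=> r_gt0 sr; rewrite /= modn_small // prednK. Qed.

Lemma val_oppZp r s : (0 < r)%N -> (0 < s < r)%N -> (- (inZp s : colour r)) = (r - s)%N :> nat.
Proof.
move=> r_gt0 /andP[s0 sr]; rewrite /= (prednK r_gt0) (@modn_small s) //.
by rewrite modn_small //; lia.
Qed.

Lemma Gamma_prod r n (g : {perm colour r * 'I_n}) : (0 < r)%N -> g \in Grn r n ->
    (forall t k, (1 <= t)%N -> (t.*2 < r)%N -> mult g t k = mult g (r - t) k) ->
  Gamma g = \prod_(1 <= k < n.+1)
    (scomp Dser (k.*2 * r)%:R 2 (mult g 0 k.*2)
     * scomp (Rser (k.*2.-1%:R / r%:R)) r%:R 1 (mult g 0 k.*2.-1)
     * (if odd r then 1 else scomp Dser (r * k)%:R 2 (mult g r./2 k))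
     * \prod_(1 <= t < ((r - (if odd r then 1 else 2))./2).+1)
         scomp Fser (k * r)%:R 2 (mult g t k + mult g (r - t) k)%N).
Proof.
move=> r_gt0 Gg hyp; have rE := prednK r_gt0.
rewrite Gamma_weight // /weight natr_prod; set m := mD g setT.
have mE s k : (s < r)%N -> m (inZp s) k = mult g s k.
  by move=> sr; rewrite -{2}(val_inZp r_gt0 sr) mult_mD.
(* The colour 0 factor is isolated because it alone is regrouped by parity of the length. *)
pose f k := (matchw (fixw (0 : colour r) k) (r * k) (m 0 k))%:R : algC.
transitivity (\prod_(1 <= k < n.+1) (f k *
  ((if odd r then 1 else scomp Dser (r * k)%:R 2 (mult g r./2 k))
   * \prod_(1 <= t < ((r - (if odd r then 1 else 2))./2).+1)
         scomp Fser (k * r)%:R 2 (mult g t k + mult g (r - t) k)%N))).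
  apply: eq_bigr => k _; rewrite natr_prod (bigID (half_colour r)) /=.
  rewrite [X in _ * X]big1 ?mulr1 => [|t /tfac_out-> //].
  rewrite prod_half // -mulrA; congr (_ * (_ * _)).
  - by rewrite /f /tfac oppr0 eqxx rE.
  - case: ifP => // /negbT ro; rewrite /tfac oppZp_half // eqxx rE.
    have r2 : (r./2 < r)%N by lia.
    rewrite mE // -matchw_Dser /fixw (_ : inZp _ == 0 = false) ?andbF //.
    by apply/negbTE; rewrite -val_eqE /= rE modn_small; lia.
  rewrite big_nat [RHS]big_nat; apply: eq_bigr => s /andP[s0 sh].
  have sr : (s.*2 < r)%N by case: ifP sh => _; lia.
  have sr' : (s < r)%N by lia.
  have e1 : (s == r - s)%N = false by apply/eqP; lia.
  have e2 : (s < r - s)%N = true by lia.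
  have E : (r - s)%N = - (inZp s : colour r) :> nat by rewrite val_oppZp ?s0.
  have v1 : val (inZp s : colour r) = s by apply: val_inZp.
  have v2 : val (- (inZp s : colour r)) = (r - s)%N by apply: val_oppZp; rewrite ?s0.
  rewrite /tfac -val_eqE v1 v2 e1 e2.
  rewrite rE mE // -[m (- _) k](mult_mD _ _ Gg) -E -hyp // mulnC.
  exact: bijw_Fser.
rewrite big_split /= (@prod_even_odd _ f) => [|k nk]; last first.
  have m0 : m 0 k = 0%N.
    rewrite /m /mD (_ : npos _ _ _ _ = 0%N) ?div0n //.
    apply: eq_card0 => i; rewrite !inE /=; apply/negbTE; rewrite negb_and; apply/orP; right.
    by rewrite neq_ltn (leq_ltn_trans (len_le g i) nk).
  by rewrite /f m0.
rewrite -big_split /= big_nat [RHS]big_nat; apply: eq_bigr => k /andP[k0 _]; rewrite -!mulrA.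
have m0 L : m 0 L = mult g 0 L.
  by rewrite -mE //; congr (m _ L); apply: val_inj; rewrite /= mod0n.
congr (_ * (_ * _)).
  by rewrite /f /fixw odd_double /= m0 matchw_Dser mulnC.
have ->: f k.*2.-1 = scomp (Rser (k.*2.-1%:R / r%:R)) r%:R 1 (mult g 0 k.*2.-1).
  have ko : odd k.*2.-1 by lia.
  by rewrite /f /fixw ko eqxx /= m0 rE matchw_Rser.
by [].
Qed.

Lemma half_opp r (t : colour r) : half_colour r t -> half_colour r (- t) -> t = - t.
Proof.
rewrite /half_colour opprK => /orP[/eqP //|lt] /orP[/eqP-> //|lt'].
by move: (ltn_trans lt lt'); rewrite ltnn.
Qed.

Lemma half_or r (t : colour r) : ~~ half_colour r t -> half_colour r (- t).
Proof.
rewrite /half_colour opprK negb_or -leqNgt => /andP[nt]; rewrite leq_eqVlt => /orP[|->].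
  by move=> /eqP/val_inj E; rewrite E eqxx in nt.
by rewrite orbT.
Qed.

(** * Summing the weights over all cycle types *)

Section CtypeSum.

Variables (r n : nat).
Local Notation I := (colour r * 'I_n)%type.

Definition oppi (i : I) : I := (- i.1, i.2).

Definition halfi : pred I := fun i => half_colour r i.1.

Lemma oppiK : involutive oppi.
Proof. by case=> t k; rewrite /oppi /= opprK. Qed.

Definition cell_weight (i : I) (v : nat) : nat :=
  if i.1 == - i.1 then matchw (fixw i.1 i.2.+1) (r.-1.+1 * i.2.+1) v
  else (v`! * (r.-1.+1 * i.2.+1) ^ v)%N.

(** Distinct opposite colours contribute two cycles of the same length at once. *)
Definition cell_size (i : I) : nat := if i.1 == - i.1 then i.2.+1 else i.2.+1.*2.

Lemma weight_cext (m : ctype r n) : weight n (cext m) =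
  (\prod_(i | halfi i) if i.1 == - i.1 then matchw (fixw i.1 i.2.+1) (r.-1.+1 * i.2.+1) (m i)
     else bijw (r.-1.+1 * i.2.+1) (m i) (m (oppi i)))%N.
Proof.
rewrite /weight big_add1 /= big_mkord exchange_big /= pair_bigA /= (bigID halfi) /=.
rewrite [X in (_ * X)%N]big1 ?muln1 => [|i /tfac_out //].
apply: eq_bigr => -[t k]; rewrite /halfi /half_colour /tfac /= !valK /oppi /=.
by case: ifP => //= _ ->.
Qed.

(** Types of nonzero weight are symmetric under colour negation; [symc] and [halfc] identify
    symmetric types with those supported on half of the colours. *)
Definition symc (f : ctype r n) : ctype r n :=
  [ffun i => if halfi i then f i else f (oppi i)].
Definition halfc (m : ctype r n) : ctype r n :=
  [ffun i => if halfi i then m i else ord0].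
Definition is_sym (m : ctype r n) := [forall i, m i == m (oppi i)].

Lemma weight_nsym m : ~~ is_sym m -> weight n (cext m) = 0%N.
Proof.
rewrite /is_sym negb_forall => /existsP[i nmi].
wlog hi : i nmi / halfi i.
  move=> H; have [/H|/half_or hi] := boolP (halfi i); first exact.
  by apply: (H (oppi i)); rewrite // oppiK eq_sym.
rewrite weight_cext (bigD1 i) //= ifN; last first.
  by apply: contra nmi => /eqP E; rewrite /oppi -E -surjective_pairing.
by rewrite /bijw -[_ == _ :> nat]/(m i == m (oppi i)) (negPf nmi) mul0n.
Qed.

Lemma symc_opp f i : symc f (oppi i) = symc f i.
Proof.
rewrite !ffunE oppiK; case: ifPn => h1; case: ifPn => // h2.
  by rewrite /oppi -(half_opp h2 h1) -surjective_pairing.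
by move: (half_or h2); rewrite -/(halfi (oppi i)) (negPf h1).
Qed.

Lemma weight_symc f : weight n (cext (symc f)) = (\prod_(i | halfi i) cell_weight i (f i))%N.
Proof.
rewrite weight_cext; apply: eq_bigr => i hi; rewrite /cell_weight symc_opp !ffunE hi.
by rewrite /bijw eqxx.
Qed.

Lemma csize_symc f : csize (symc f) = (\sum_(i | halfi i) cell_size i * f i)%N.
Proof.
rewrite /csize (bigID halfi) /= [X in (_ + X)%N](reindex_inj (can_inj oppiK)) /=.
rewrite [X in (_ + X)%N](_ : _ = \sum_(i | halfi i && (i.1 != - i.1)) i.2.+1 * f i)%N.
  rewrite [X in (_ + X)%N]big_mkcondr -big_split; apply: eq_bigr => i hi.
  rewrite ffunE hi /cell_size; case: eqP => _ /=; first by rewrite addn0.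
  by rewrite -mul2n -mulnA mul2n addnn.
apply: eq_big => [i|i nhi].
  apply/idP/andP => [nh|[hi ne]].
    have hi : halfi i by have := half_or nh; rewrite /= opprK.
    split=> //; apply: contra nh => /eqP E.
    by rewrite /halfi /= -E.
  by apply: contra ne => h'; apply/eqP/half_opp.
by rewrite symc_opp ffunE ifT //; have := half_or nhi; rewrite /= opprK.
Qed.

(** Expanding the product chooses a multiplicity in each half cell, that is, a symmetric type; the
    size is recorded in the exponent and selected only later. *)
Lemma ctype_sum_prod :
  \sum_(m : ctype r n) (weight n (cext m))%:R *: 'X^(csize m) =
  \prod_(i | halfi i) \sum_(v < n.+1) (cell_weight i v)%:R *: 'X^(cell_size i * v) :> {poly algC}.
Proof.
rewrite (big_distr_big_dep ord0).
rewrite (bigID is_sym) /= [X in _ + X]big1 ?addr0 => [|m /weight_nsym->]; last by rewrite scale0r.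
rewrite (reindex_onto symc halfc) /= => [|m /forallP sm]; last first.
  apply/ffunP=> i; rewrite !ffunE; have [//|nhi] := boolP (halfi i).
  by have h : halfi (oppi i) := half_or nhi; rewrite h (eqP (sm i)).
apply: eq_big => [f|f _].
  have ->: is_sym (symc f) by apply/forallP=> i; rewrite symc_opp.
  apply/eqP/pfamilyP => [E|[/subsetP sf _]].
    split=> //; apply/subsetP=> i; apply: contraR => nhi.
    by rewrite -E ffunE ifN.
  apply/ffunP=> i; rewrite !ffunE; have [//|nhi] := boolP (halfi i).
  by apply/esym/eqP; apply: contraNT nhi => /sf.
rewrite weight_symc csize_symc natr_prod scaler_prod; congr (_ *: _).
by rewrite prodrXr.
Qed.

End CtypeSum.

Lemma table_sum_coef r n : table_sum (Grn r n) =
  (\prod_(1 <= k < n.+1) \prod_(t : colour r | half_colour r t)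
     \sum_(v < n.+1) (if t == - t
       then (matchw (fixw t k) (r.-1.+1 * k) v)%:R *: 'X^(k * v)
       else (v`! * (r.-1.+1 * k) ^ v)%:R *: 'X^(k.*2 * v)))`_n.
Proof.
rewrite table_sum_ctype big_add1 /= big_mkord.
have ->: \prod_(k < n) \prod_(t : colour r | half_colour r t)
     \sum_(v < n.+1) (if t == - t
       then (matchw (fixw t k.+1) (r.-1.+1 * k.+1) v)%:R *: 'X^(k.+1 * v)
       else (v`! * (r.-1.+1 * k.+1) ^ v)%:R *: 'X^(k.+1.*2 * v)) =
  \sum_(m : ctype r n) (weight n (cext m))%:R *: 'X^(csize m) :> {poly algC}.
  rewrite ctype_sum_prod exchange_big /= (pair_big_dep _ (fun _ _ => true)) /=.
  apply: eq_big => [i|i _]; first by rewrite andbT.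
  by apply: eq_bigr => v _; rewrite /cell_weight /cell_size; case: ifP.
rewrite coef_sum big_mkcond; apply: eq_bigr => m _.
by rewrite coefZ coefXn eq_sym; case: eqP => _; rewrite ?mulr1 ?mulr0.
Qed.

(** Congruence modulo ['X^(n.+1)], under which products of series become products in the polynomial
    ring. *)
Definition coef_cong n (p q : {poly algC}) := forall i, (i <= n)%N -> p`_i = q`_i.

Lemma coef_congM n p q p' q' : coef_cong n p p' -> coef_cong n q q' ->
  coef_cong n (p * q) (p' * q').
Proof.
move=> E E' i ni; rewrite !coefM; apply: eq_bigr => -[j ji] _ /=.
by rewrite E ?E' //; apply: leq_trans ni; rewrite ?leq_subr.
Qed.

Lemma coef_cong_prod n (I : Type) (s : seq I) (P : pred I) (F F' : I -> {poly algC}) :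
  (forall k, P k -> coef_cong n (F k) (F' k)) ->
  coef_cong n (\prod_(k <- s | P k) F k) (\prod_(k <- s | P k) F' k).
Proof. by move=> E; apply: (big_rec2 (coef_cong n)) => // k q p Pk; apply: coef_congM (E k Pk). Qed.

Definition trunc n (A : series) : {poly algC} := \poly_(i < n.+1) A i.

Lemma trunc_smul n A B : coef_cong n (trunc n (smul A B)) (trunc n A * trunc n B).
Proof.
move=> i ni; rewrite coef_poly ltnS ni coefM; apply: eq_bigr => -[j ji] _ /=.
by rewrite !coef_poly !ltnS (leq_trans (leq_subr _ _) ni) (leq_trans _ ni).
Qed.

Lemma trunc_smul_cong n A B p q :
  coef_cong n (trunc n A) p -> coef_cong n (trunc n B) q ->
  coef_cong n (trunc n (smul A B)) (p * q).
Proof. by move=> EA EB i ni; rewrite trunc_smul //; apply: coef_congM ni. Qed.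

Lemma trunc_sone n : coef_cong n (trunc n sone) 1.
Proof. by move=> i ni; rewrite coef_poly ltnS ni coef1. Qed.

Lemma trunc_spow n A e : coef_cong n (trunc n (spow A e)) (trunc n A ^+ e).
Proof.
elim: e => [|e IH]; first exact: trunc_sone.
by rewrite exprS; apply: trunc_smul_cong.
Qed.

Lemma iprod_coefE (P : nat -> series) n :
  iprod_coef P n = (\prod_(1 <= k < n.+1) trunc n (P k))`_n.
Proof.
transitivity (trunc n (\big[smul/sone]_(1 <= k < n.+1) P k))`_n.
  by rewrite coef_poly leqnn.
suff E : coef_cong n (trunc n (\big[smul/sone]_(1 <= k < n.+1) P k))
    (\prod_(1 <= k < n.+1) trunc n (P k)) by apply: E.
apply: (big_rec2 (fun A p => coef_cong n (trunc n A) p)) => [|k p A _ E]; first exact: trunc_sone.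
exact: trunc_smul_cong.
Qed.

(** As [L] is positive, terms with [v > n] would have degree beyond [n]. *)
Lemma sum_cong_trunc n L (w : nat -> nat) (A : series) : (0 < L)%N ->
    (forall i, A i = if (L %| i)%N then (w (i %/ L)%N)%:R else 0) ->
  coef_cong n (\sum_(v < n.+1) (w v)%:R *: 'X^(L * v)) (trunc n A).
Proof.
move=> L_gt0 AE i ni; rewrite coef_sum coef_poly ltnS ni AE.
have [dv|ndv] := boolP (L %| i)%N; last first.
  rewrite big1 // => v _; rewrite coefZ coefXn; case: eqP => [E|_]; last by rewrite mulr0.
  by rewrite E dvdn_mulr in ndv.
have qn : (i %/ L < n.+1)%N by rewrite ltnS (leq_trans (leq_div _ _)).
rewrite (bigD1 (Ordinal qn)) //= coefZ coefXn mulnC divnK // eqxx mulr1.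
rewrite big1 ?addr0 // => v nv; rewrite coefZ coefXn; case: eqP => [E|_]; last by rewrite mulr0.
by case/eqP: nv; apply: val_inj; rewrite /= E mulKn.
Qed.

Lemma scomp_Dser b k i : (0 < k)%N ->
  scomp Dser b%:R k.*2 i = if (k %| i)%N then (matchw 0 b (i %/ k))%:R else 0.
Proof.
move=> k_gt0; rewrite matchw_Dser /scomp double_gt0 k_gt0 /= -muln2 divnMA.
have [dv|ndv] := boolP (k %| i)%N; first by rewrite dvdn_divRL // mulnC.
by rewrite ifN //; apply: contra ndv; apply: dvdn_trans; rewrite dvdn_mulr.
Qed.

Lemma scomp_Rser a c k i : (0 < a)%N -> (0 < k)%N ->
  scomp (Rser (c%:R / a%:R)) a%:R k i =
    if (k %| i)%N then (matchw a (a * c) (i %/ k))%:R else 0.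
Proof.
by move=> a_gt0 k_gt0; rewrite matchw_Rser // /scomp k_gt0 /= dvd1n divn1.
Qed.

Lemma scomp_Fser b k i : (0 < k)%N ->
  scomp Fser b%:R k i =
    if (k %| i)%N then ((i %/ k)`! * b ^ (i %/ k))%:R else 0.
Proof. by move=> k_gt0; rewrite /scomp k_gt0 /= natrM natrX. Qed.

Section TableSum.

Variables (r n : nat).
Hypothesis r_gt0 : (0 < r)%N.

(** The factor of colour 0 and length [k], not yet split by the parity of [k]. *)
Definition zero_ser k : series := fun i =>
  if (k %| i)%N then (matchw (fixw (0 : colour r) k) (r * k) (i %/ k))%:R else 0.

Lemma zero_ser_even k : (0 < k)%N ->
  trunc n (zero_ser k.*2) = trunc n (scomp Dser (k.*2 * r)%:R (4 * k)).
Proof.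
move=> k_gt0; apply/polyP=> i; rewrite !coef_poly; case: ifP => // _.
have ->: (4 * k = k.*2.*2)%N by lia.
rewrite scomp_Dser ?double_gt0 // /zero_ser /fixw odd_double /= mulnC //.
Qed.

Lemma zero_ser_odd k : (0 < k)%N ->
  trunc n (zero_ser k.*2.-1) =
    trunc n (scomp (Rser (k.*2.-1%:R / r%:R)) r%:R k.*2.-1).
Proof.
move=> k_gt0; apply/polyP=> i; rewrite !coef_poly; case: ifP => // _.
have ko : odd k.*2.-1 by lia.
have k0 : (0 < k.*2.-1)%N by lia.
by rewrite scomp_Rser // /zero_ser /fixw ko eqxx /= (prednK r_gt0).
Qed.

Lemma zero_ser_gt k : (n < k)%N -> trunc n (zero_ser k) = 1.
Proof.
move=> nk; apply/polyP=> i; rewrite coef_poly coef1; case: ifP => [|/negbT]; last first.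
  by rewrite -leqNgt; case: i.
rewrite ltnS => ni; rewrite /zero_ser; have [->|i_gt0] := posnP i; first by rewrite dvdn0 div0n.
by rewrite gtnNdvd // ?(leq_ltn_trans ni nk) //; case: i i_gt0 {ni}.
Qed.

Lemma table_sum_trunc : table_sum (Grn r n) =
  (\prod_(1 <= k < n.+1)
     (trunc n (scomp Fser (k * r)%:R k.*2) ^+ (r - (if odd r then 1%N else 2%N))./2
      * trunc n (scomp Dser (k.*2 * r)%:R (4 * k))
      * (if odd r then 1 else trunc n (scomp Dser (r * k)%:R k.*2))
      * trunc n (scomp (Rser (k.*2.-1%:R / r%:R)) r%:R k.*2.-1)))`_n.
Proof.
have rE := prednK r_gt0; pose h := ((r - (if odd r then 1%N else 2%N))./2)%N.
rewrite table_sum_coef.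
transitivity (\prod_(1 <= k < n.+1) (trunc n (zero_ser k) *
   ((if odd r then 1 else trunc n (scomp Dser (r * k)%:R k.*2))
   * trunc n (scomp Fser (k * r)%:R k.*2) ^+ h)))`_n.
  rewrite big_nat [in RHS]big_nat; apply: coef_cong_prod (leqnn n) => k /andP[k_gt0 _].
  rewrite prod_half // -mulrA; apply: coef_congM.
    rewrite oppr0 eqxx rE; apply: sum_cong_trunc => // i.
  apply: coef_congM.
    case: ifP => // /negbT ro; rewrite oppZp_half // eqxx rE.
    apply: sum_cong_trunc => // i; rewrite scomp_Dser // /fixw.
    rewrite (_ : inZp _ == 0 = false) ?andbF //.
    by apply/negbTE; rewrite -val_eqE /= rE modn_small; lia.
  (* The [h] pairs of distinct opposite colours have equal factors, which produces the power of
     [Fser]. *)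
  rewrite -/h -[h in X in coef_cong _ _ X](subn1 h.+1) -prodr_const_nat.
  rewrite big_nat [X in coef_cong _ _ X]big_nat; apply: coef_cong_prod => s /andP[s0 sh].
  have sr : (s.*2 < r)%N by move: sh; rewrite /h; case: ifP => _; lia.
  have e1 : (s == r - s)%N = false by apply/eqP; lia.
  have sr' : (s < r)%N by lia.
  have ->: (inZp s == - inZp s :> colour r) = false.
    have v1 : val (inZp s : colour r) = s by apply: val_inZp.
    have v2 : val (- (inZp s : colour r)) = (r - s)%N by apply: val_oppZp; rewrite ?s0.
    by rewrite -val_eqE v1 v2 e1.
  have b_gt0 : (0 < k.*2)%N by rewrite double_gt0.
  rewrite rE; apply: (@sum_cong_trunc n k.*2 (fun v => (v`! * (r * k) ^ v)%N)) => // i.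
  by rewrite scomp_Fser // (mulnC k).
apply: (congr1 (fun p : {poly algC} => p`_n)).
rewrite big_split /= (prod_even_odd zero_ser_gt) -big_split /=.
rewrite big_nat [RHS]big_nat; apply: eq_bigr => k /andP[k_gt0 _].
rewrite zero_ser_even // zero_ser_odd //; ring.
Qed.

End TableSum.

Theorem theorem6p15 (r : nat) (hr : (0 < r)%N) :
  (* Part 1: Gamma_lambda as a coefficient *)
  (forall (n : nat) (g : {perm colour r * 'I_n}),
     g \in Grn r n ->
     (forall t k : nat, (1 <= t)%N -> (t.*2 < r)%N -> mult g t k = mult g (r - t) k) ->
     Gamma g =
       if odd r then
         \prod_(1 <= k < n.+1)
           (scomp Dser (k.*2 * r)%:R 2 (mult g 0 k.*2)
            * scomp (Rser ((k.*2.-1)%:R / r%:R)) r%:R 1 (mult g 0 k.*2.-1)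
            * \prod_(1 <= t < ((r - 1)./2).+1)
                scomp Fser (k * r)%:R 2 (mult g t k + mult g (r - t) k)%N)
       else
         \prod_(1 <= k < n.+1)
           (scomp Dser (k.*2 * r)%:R 2 (mult g 0 k.*2)
            * scomp Dser (r * k)%:R 2 (mult g r./2 k)
            * scomp (Rser ((k.*2.-1)%:R / r%:R)) r%:R 1 (mult g 0 k.*2.-1)
            * \prod_(1 <= t < ((r - 2)./2).+1)
                scomp Fser (k * r)%:R 2 (mult g t k + mult g (r - t) k)%N))
  /\
  (* Part 2: generating function of the character table sums *)
  (forall n : nat,
     table_sum (Grn r n) =
       if odd r then
         iprod_coef (fun k =>
           smul (smul (spow (scomp Fser (k * r)%:R k.*2) (r - 1)./2)
                      (scomp Dser (k.*2 * r)%:R (4 * k)))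
                (scomp (Rser ((k.*2.-1)%:R / r%:R)) r%:R k.*2.-1)) n
       else
         iprod_coef (fun k =>
           smul (smul (smul (spow (scomp Fser (k * r)%:R k.*2) (r - 2)./2)
                            (scomp Dser (k.*2 * r)%:R (4 * k)))
                      (scomp Dser (r * k)%:R k.*2))
                (scomp (Rser ((k.*2.-1)%:R / r%:R)) r%:R k.*2.-1)) n).
Proof.
split=> [n g Gg hyp|n].
  rewrite (Gamma_prod hr Gg hyp); case: ifP => _; apply: eq_bigr => k _.
    by rewrite mulr1.
  by congr (_ * _); rewrite mulrAC.
rewrite table_sum_trunc //; case: ifP => _; rewrite iprod_coefE; symmetry.
  apply: coef_cong_prod (leqnn n) => k _; rewrite mulr1.
  by apply: trunc_smul_cong => //; apply: trunc_smul_cong => //; apply: trunc_spow.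
apply: coef_cong_prod (leqnn n) => k _.
apply: trunc_smul_cong => //; apply: trunc_smul_cong => //.
by apply: trunc_smul_cong => //; apply: trunc_spow.
Qed.
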